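(* Let $1\le q<\infty$ and let $X$ be a path-connected space having the homotopy type of a CW-complex. Suppose that $X$ admits a $q$-finite $q$-model (over $\mathbb{C}$). If $\mathcal{M}_q(X)$ is the Sullivan $q$-minimal model of $X$, then $\dim H^i(\mathcal{M}_q(X))<\infty$ for all $i\le q+1$.
   Context: A cdga over a field $\Bbbk$ of characteristic $0$ is a non-negatively graded, graded-commutative differential graded $\Bbbk$-algebra $A=(A^{\bullet},d)$ with $d$ of degree $+1$. It is connected if $A^0=\Bbbk\cdot 1$, and it is $q$-finite if it is connected and $\sum_{i\le q}\dim A^i<\infty$. A cdga map is a $q$-equivalence if it induces isomorphisms in cohomology in degrees $\le q$ and a monomorphism in degree $q+1$. Two cdgas $A,B$ have the same $q$-type, written $A\simeq_q B$, if they are connected by a zig-zag of $q$-equivalences. $\Omega(X)$ denotes Sullivan's cdga of piecewise polynomial, complex-valued forms on $X$; it satisfies $H^{\bullet}(\Omega(X))\cong H^{\bullet}(X,\mathbb{C})$. A $q$-model for $X$ is a cdga $A$ over $\mathbb{C}$ with $A\simeq_q\Omega(X)$. A Hirsch extension of degree $i$ of a cdga $B$ is a cdga of the form $B\otimes\bigwedge U$, with $U$ a vector space placed in degree $i$, whose differential extends that of $B$ and satisfies $d(U)\subseteq Z^{i+1}(B)$. A cdga is $q$-minimal if it is of the form $(\bigwedge V,d)$ with $\bigwedge V$ the free graded-commutative algebra on a graded vector space $V=\bigoplus_{0<i\le q}V^i$ and with differential structure the inductive limit of a sequence of Hirsch extensions of increasing degrees. Every cdga $A$ with connected cohomology admits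 a $q$-equivalence $(\bigwedge V,d)\to A$ from a $q$-minimal cdga, which is unique up to isomorphism and denoted $\mathcal{M}_q(A)$. Set $\mathcal{M}_q(X):=\mathcal{M}_q(\Omega(X))$. *)

(* Defs.v *)
From HB Require Import structures.
From mathcomp Require Import all_boot all_order all_algebra.
From mathcomp Require Import all_classical all_reals all_analysis.
From mathcomp Require Import complex.

Set Implicit Arguments.
Unset Strict Implicit.
Unset Printing Implicit Defensive.

Import Order.TTheory GRing.Theory Num.Theory.
Import numFieldNormedType.Exports.

Local Open Scope classical_set_scope.
Local Open Scope ring_scope.

(* A decomposition of V as the direct sum of the subspaces V^n = hcomp n V, given
   by the projections hcomp n onto the summands. *)
Record grading (K : fieldType) (V : lmodType K) := Grading {
  hcomp : nat -> {linear V -> V};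
  hcompK : forall i j x, hcomp i (hcomp j x) = if i == j then hcomp j x else 0;
  hcomp_sum : forall x, exists N, x = \sum_(i < N) hcomp i x }.

Definition homog_of (K : fieldType) (V : lmodType K) (g : grading V) (n : nat) :
  {pred V} := [pred x | hcomp g n x == x].

(* Graded-commutative algebras. As an algType is nonzero by definition, the zero
   algebra is excluded; 1 <> 0 holds in every cdga with connected cohomology. *)
Record gca (K : fieldType) := GCA {
  gca_alg :> algType K;
  gca_grading : grading gca_alg;
  gca_one : 1 \in homog_of gca_grading 0;
  gca_mul : forall i j x y, x \in homog_of gca_grading i ->
    y \in homog_of gca_grading j -> x * y \in homog_of gca_grading (i + j);
  gca_comm : forall i j x y, x \in homog_of gca_grading i ->
    y \in homog_of gca_grading j -> x * y = (-1) ^+ (i * j) * (y * x) }.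

Definition homog (K : fieldType) (A : gca K) (n : nat) : {pred A} :=
  homog_of (gca_grading A) n.
Arguments homog {K} A n : simpl never.

Record cdga (K : fieldType) := CDGA {
  cdga_gca :> gca K;
  dif : {linear cdga_gca -> cdga_gca};
  dif_homog : forall n x, x \in homog cdga_gca n -> dif x \in homog cdga_gca n.+1;
  dif_dif : forall x, dif (dif x) = 0;
  dif_leibniz : forall i x y, x \in homog cdga_gca i ->
    dif (x * y) = dif x * y + (-1) ^+ i * (x * dif y) }.
Arguments dif {K} c.

Record gca_hom (K : fieldType) (A B : gca K) := GCAHom {
  gca_fun :> {lrmorphism A -> B};
  gca_fun_homog : forall n x, x \in homog A n -> gca_fun x \in homog B n }.

Record cdga_hom (K : fieldType) (A B : cdga K) := CDGAHom {
  cdga_fun :> gca_hom A B;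
  cdga_fun_dif : forall x, cdga_fun (dif A x) = dif B (cdga_fun x) }.

Section GradingTheory.
Variables (K : fieldType) (V : lmodType K) (g : grading V).

Lemma homogP n x : reflect (hcomp g n x = x) (x \in homog_of g n).
Proof. exact: eqP. Qed.

Lemma homog_hcomp n x : hcomp g n x \in homog_of g n.
Proof. by apply/homogP; rewrite hcompK eqxx. Qed.

Lemma hcomp_homog m n x : x \in homog_of g n ->
  hcomp g m x = if m == n then x else 0.
Proof. by move/homogP => <-; rewrite hcompK. Qed.

Lemma homog_ind (P : V -> Prop) :
  P 0 -> (forall x y, P x -> P y -> P (x + y)) ->
  (forall n x, x \in homog_of g n -> P x) -> forall x, P x.
Proof.
move=> P0 PD Ph x; have [N ->] := hcomp_sum g x.
by apply: big_ind => // i _; apply: Ph (homog_hcomp i x).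
Qed.

Lemma homog_submod n : submod_closed (homog_of g n).
Proof.
split=> [|a x y /homogP hx /homogP hy]; apply/homogP; first exact: raddf0.
by rewrite linearP hx hy.
Qed.
HB.instance Definition _ n :=
  GRing.isSubmodClosed.Build K V (homog_of g n) (homog_submod n).

Lemma sum_ord_tail (F : nat -> V) N M : (N <= M)%N ->
  (forall i, (N <= i)%N -> F i = 0) -> \sum_(i < M) F i = \sum_(i < N) F i.
Proof.
move=> NM F0; rewrite (big_ord_widen M F NM) [RHS]big_mkcond /=.
by apply: eq_bigr => i _; case: ltnP => // /F0.
Qed.

Lemma hcomp_bound x : exists N, forall i, (N <= i)%N -> hcomp g i x = 0.
Proof.
have [N xE] := hcomp_sum g x; exists N => i Ni; rewrite xE linear_sum big1 //= => j _.
by rewrite hcompK ifN // neq_ltn (leq_trans (ltn_ord j)) ?orbT.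
Qed.

Lemma hcomp_sumE x N : (forall i, (N <= i)%N -> hcomp g i x = 0) ->
  x = \sum_(i < N) hcomp g i x.
Proof.
move=> hN; have [M xE] := hcomp_sum g x.
pose F i := hcomp g i x.
rewrite -(@sum_ord_tail F N (maxn M N)) ?leq_maxr //.
rewrite (@sum_ord_tail F M) ?leq_maxl // => i Mi.
rewrite /F xE linear_sum big1 //= => j _.
by rewrite hcompK ifN // neq_ltn (leq_trans (ltn_ord j)) ?orbT.
Qed.

Lemma homog_eq (W : lmodType K) (f h : {linear V -> W}) :
  (forall n x, x \in homog_of g n -> f x = h x) -> f =1 h.
Proof.
move=> fh; apply: homog_ind fh => [|x y fx fy]; first by rewrite !linear0.
by rewrite !linearD fx fy.
Qed.

(* The involution acting as (-1)^n on V^n. *)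
Definition parity (x : V) : V :=
  \sum_(i < sval (cid (hcomp_sum g x))) (-1) ^+ i *: hcomp g i x.

Lemma parityE x N : (forall i, (N <= i)%N -> hcomp g i x = 0) ->
  parity x = \sum_(i < N) (-1) ^+ i *: hcomp g i x.
Proof.
move=> hN; rewrite /parity; case: cid => M /= xE; pose F i := (-1) ^+ i *: hcomp g i x.
rewrite -(@sum_ord_tail F M (maxn M N)) ?leq_maxl //.
  rewrite (@sum_ord_tail F N) ?leq_maxr // => i Ni.
  by rewrite /F hN // scaler0.
move=> i Mi; rewrite /F xE linear_sum big1 /= ?scaler0 // => j _.
by rewrite hcompK ifN // neq_ltn (leq_trans (ltn_ord j)) ?orbT.
Qed.

Lemma parity_linear : linear parity.
Proof.
move=> a x y; have [[N hN] [M hM]] := (hcomp_bound x, hcomp_bound y).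
have hx i : (maxn N M <= i)%N -> hcomp g i x = 0.
  by rewrite geq_max => /andP[/hN].
have hy i : (maxn N M <= i)%N -> hcomp g i y = 0.
  by rewrite geq_max => /andP[_ /hM].
rewrite (parityE hx) (parityE hy) (@parityE _ (maxn N M)); last first.
  by move=> i iNM; rewrite linearP /= hx // hy // scaler0 addr0.
rewrite scaler_sumr -big_split /=; apply: eq_bigr => i _.
by rewrite linearP scalerDr !scalerA mulrC.
Qed.
HB.instance Definition _ := GRing.isLinear.Build K V V _ parity parity_linear.

Lemma parity_homog n x : x \in homog_of g n -> parity x = (-1) ^+ n *: x.
Proof.
move=> hx; rewrite (@parityE x n.+1) => [|i ni]; last first.
  by rewrite (hcomp_homog i hx) gtn_eqF.
rewrite big_ord_recr /= (hcomp_homog _ hx) eqxx big1 ?add0r // => i _.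
by rewrite (hcomp_homog _ hx) ltn_eqF ?scaler0.
Qed.

Lemma hcomp_parity n x : hcomp g n (parity x) = (-1) ^+ n *: hcomp g n x.
Proof.
pose f : {linear V -> V} := hcomp g n \o parity.
pose h : {linear V -> V} := ( *:%R ((-1) ^+ n) : V -> V) \o hcomp g n.
apply: (@homog_eq _ f h) => m y hy.
rewrite /f /h /= (parity_homog hy) linearZ /= (hcomp_homog _ hy).
by case: eqP => [->//|]; rewrite !scaler0.
Qed.

Lemma parityK : involutive parity.
Proof.
apply: (@homog_eq _ (parity \o parity) idfun) => n x hx /=.
rewrite (parity_homog hx) linearZ /= (parity_homog hx).
by rewrite scalerA -expr2 sqrr_sign scale1r.
Qed.

End GradingTheory.

Section CdgaTheory.
Variables (K : fieldType) (A : cdga K).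
Implicit Types x y : A.

Definition par : A -> A := parity (gca_grading A).
HB.instance Definition _ := GRing.Linear.on par.

Lemma par_homog n x : x \in homog A n -> par x = (-1) ^+ n *: x.
Proof. exact: parity_homog. Qed.

Lemma bihomog_eq (W : lmodType K) (f h : A -> A -> W) :
  (forall y, linear (f^~ y)) -> (forall x, linear (f x)) ->
  (forall y, linear (h^~ y)) -> (forall x, linear (h x)) ->
  (forall i j x y, x \in homog A i -> y \in homog A j -> f x y = h x y) ->
  forall x y, f x y = h x y.
Proof.
move=> fl fr hl hr fh x y.
pose lin (k : A -> W) (kl : linear k) :=
  HB.pack_for {linear A -> W} k (GRing.isLinear.Build K A W _ k kl).
apply: (@homog_eq _ _ (gca_grading A) _ (lin _ (fl y)) (lin _ (hl y))) => i {}x hx /=.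
apply: (@homog_eq _ _ (gca_grading A) _ (lin _ (fr x)) (lin _ (hr x))) => j {}y hy /=.
exact: fh hx hy.
Qed.

Lemma par1 : par 1 = 1.
Proof. by rewrite (par_homog (gca_one A)) scale1r. Qed.

Lemma parM x y : par (x * y) = par x * par y.
Proof.
move: x y; apply: bihomog_eq => [y a u v|x a u v|y a u v|x a u v|i j x y hx hy] /=.
- by rewrite mulrDl -scalerAl linearP.
- by rewrite mulrDr -scalerAr linearP.
- by rewrite linearP mulrDl -scalerAl.
- by rewrite linearP mulrDr -scalerAr.
rewrite (par_homog (gca_mul hx hy)) (par_homog hx) (par_homog hy).
by rewrite -scalerAl -scalerAr scalerA exprD.
Qed.

Lemma dif_par x : dif A (par x) = - par (dif A x).
Proof.
pose f : {linear A -> A} := dif A \o par.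
pose h : {linear A -> A} := -%R \o (par \o dif A).
apply: (@homog_eq _ _ (gca_grading A) _ f h) => n {}x hx.
rewrite /f /h /= (par_homog hx) (par_homog (dif_homog hx)) linearZ /=.
by rewrite exprS mulN1r scaleNr opprK.
Qed.

Lemma dif_mul x y : dif A (x * y) = dif A x * y + par x * dif A y.
Proof.
move: x y; apply: bihomog_eq => [y a u v|x a u v|y a u v|x a u v|i j x y hx hy] /=.
- by rewrite mulrDl -scalerAl linearP.
- by rewrite mulrDr -scalerAr linearP.
- by rewrite !linearP !mulrDl -!scalerAl scalerDr addrACA.
- by rewrite !linearP !mulrDr -!scalerAr scalerDr addrACA.
by rewrite (dif_leibniz _ hx) (par_homog hx) -scalerAl -signr_odd -[in RHS]signr_odd; case: odd;
  rewrite ?expr0 ?expr1 ?mulN1r ?scaleN1r ?mul1r ?scale1r.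
Qed.

Lemma mul0C x y : x \in homog A 0 -> x * y = y * x.
Proof.
move=> hx; move: y; pose f : A -> A := fun y => x * y; pose h : A -> A := fun y => y * x.
have fl : linear f by move=> a u v; rewrite /f mulrDr -scalerAr.
have hl : linear h by move=> a u v; rewrite /h mulrDl -scalerAl.
pose lin (k : A -> A) (kl : linear k) :=
  HB.pack_for {linear A -> A} k (GRing.isLinear.Build K A A _ k kl).
apply: (@homog_eq _ _ (gca_grading A) _ (lin _ fl) (lin _ hl)) => j y hy.
by rewrite /= /f /h (gca_comm hx hy) mul1r.
Qed.

Lemma mul_parC1 x y : y \in homog A 1 -> y * x = par x * y.
Proof.
move=> hy; move: x; pose f : A -> A := fun x => y * x; pose h : A -> A := fun x => par x * y.
have fl : linear f by move=> a u v; rewrite /f mulrDr -scalerAr.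
have hl : linear h by move=> a u v; rewrite /h linearP mulrDl -scalerAl.
pose lin (k : A -> A) (kl : linear k) :=
  HB.pack_for {linear A -> A} k (GRing.isLinear.Build K A A _ k kl).
apply: (@homog_eq _ _ (gca_grading A) _ (lin _ fl) (lin _ hl)) => j x hx.
rewrite /= /f /h (gca_comm hy hx) mul1n (par_homog hx) -scalerAl.
by rewrite -signr_odd -[in RHS]signr_odd; case: odd;
  rewrite ?expr0 ?expr1 ?mulN1r ?scaleN1r ?mul1r ?scale1r.
Qed.

Lemma hc_dif n x : hcomp (gca_grading A) n.+1 (dif A x) = dif A (hcomp (gca_grading A) n x).
Proof.
apply: (@homog_eq _ _ (gca_grading A) _ (hcomp (gca_grading A) n.+1 \o dif A)
  (dif A \o hcomp (gca_grading A) n)) => m {}x hx /=.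
rewrite (hcomp_homog _ (dif_homog hx)) (hcomp_homog _ hx) eqSS.
by case: eqP; rewrite ?linear0.
Qed.

End CdgaTheory.

Section Par.
Variables (K : fieldType) (A : cdga K).
Lemma par_monoid_morphism : monoid_morphism (@par K A).
Proof. by split; [exact: par1 | exact: parM]. Qed.
HB.instance Definition _ :=
  GRing.isMonoidMorphism.Build A A (@par K A) par_monoid_morphism.
End Par.

(* The cdga A[t,dt] = A (x) K[t] (x) /\(dt), with t in degree 0. The pair (p, q)
   stands for p + q dt, where p and q are polynomials in t with coefficients in A;
   as dt has degree 1, dt * p = p^par * dt. *)
Definition pext_type (K : fieldType) (A : cdga K) := ({poly A} * {poly A})%type.

Section Pext.
Variables (K : fieldType) (A : cdga K).
Local Notation P := (pext_type A).
Local Notation "p ^par" := (map_poly (@par K A) p) (at level 1, format "p ^par").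
Local Notation "p ^dif" := (map_poly (dif A) p) (at level 1, format "p ^dif").

HB.instance Definition _ := GRing.Zmodule.copy P ({poly A} * {poly A})%type.

Definition pext_one : P := (1, 0).
Definition pext_mul (x y : P) : P := (x.1 * y.1, x.1 * y.2 + x.2 * y.1^par).

Lemma pext_mulA : associative pext_mul.
Proof.
move=> x y z; rewrite /pext_mul /= rmorphM /= mulrA.
by congr (_, _); rewrite mulrDr mulrDl !mulrA addrA.
Qed.
Lemma pext_mul1 : left_id pext_one pext_mul.
Proof. by case=> p q; rewrite /pext_mul /= !mul1r mul0r addr0. Qed.
Lemma pext_mulr1 : right_id pext_one pext_mul.
Proof. by case=> p q; rewrite /pext_mul /= rmorph1 mulr0 !mulr1 add0r. Qed.
Lemma pext_mulDl : left_distributive pext_mul +%R.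
Proof. by move=> x y z; rewrite /pext_mul /= !mulrDl; congr (_, _); rewrite addrACA. Qed.
Lemma pext_mulDr : right_distributive pext_mul +%R.
Proof.
by move=> x y z; rewrite /pext_mul /= rmorphD !mulrDr; congr (_, _); rewrite addrACA.
Qed.
Lemma pext_oner_neq0 : pext_one != 0.
Proof.
apply/eqP => H; have /eqP := congr1 (fun z : P => z.1) H.
by rewrite /= oner_eq0.
Qed.
HB.instance Definition _ := GRing.Zmodule_isNzRing.Build P
  pext_mulA pext_mul1 pext_mulr1 pext_mulDl pext_mulDr pext_oner_neq0.

Definition pext_scale (k : K) (x : P) : P := (k%:A *: x.1, k%:A *: x.2).
Lemma pext_scaleA a b x : pext_scale a (pext_scale b x) = pext_scale (a * b) x.
Proof. by rewrite /pext_scale /= !scalerA mulr_algl scalerA. Qed.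
Lemma pext_scale1 : left_id 1 pext_scale.
Proof. by case=> p q; rewrite /pext_scale /= !scale1r. Qed.
Lemma pext_scaleDr : right_distributive pext_scale +%R.
Proof. by move=> a x y; rewrite /pext_scale /= !scalerDr. Qed.
Lemma pext_scaleDl x : {morph pext_scale^~ x : a b / a + b}.
Proof. by move=> a b; rewrite /pext_scale !scalerDl. Qed.
HB.instance Definition _ := GRing.Zmodule_isLmodule.Build K P
  pext_scaleA pext_scale1 pext_scaleDr pext_scaleDl.

Lemma pext_scaleAl (k : K) (x y : P) : k *: (x * y) = (k *: x) * y.
Proof.
rewrite /GRing.scale /= /GRing.mul /= /pext_scale /pext_mul /=.
by rewrite -!scalerAl scalerDr.
Qed.
HB.instance Definition _ := GRing.Lmodule_isLalgebra.Build K P pext_scaleAl.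

Lemma alg_polyC (k : K) (p q : {poly A}) : k%:A *: (p * q) = p * (k%:A *: q).
Proof.
apply/polyP => i; rewrite coefZ !coefM mulr_sumr; apply: eq_bigr => j _.
by rewrite coefZ !mulr_algl scalerAr.
Qed.
Lemma par_alg (k : K) (p : {poly A}) : (k%:A *: p)^par = k%:A *: p^par.
Proof. by apply/polyP => i; rewrite !(coef_map, coefZ) /= !mulr_algl linearZ. Qed.

Lemma pext_scaleAr (k : K) (x y : P) : k *: (x * y) = x * (k *: y).
Proof.
rewrite /GRing.scale /= /GRing.mul /= /pext_scale /pext_mul /=.
by rewrite -!alg_polyC par_alg -alg_polyC scalerDr.
Qed.
HB.instance Definition _ := GRing.Lalgebra_isAlgebra.Build K P pext_scaleAr.

Local Notation hA := (hcomp (gca_grading A)).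
Definition pext_hc (n : nat) (x : P) : P :=
  (map_poly (hA n) x.1, if n is m.+1 then map_poly (hA m) x.2 else 0).

Lemma coefK (k : K) (p : {poly A}) i : (k%:A *: p)`_i = k *: p`_i.
Proof. by rewrite coefZ mulr_algl. Qed.
Lemma coef_pext_hc2 n x i :
  (pext_hc n x).2`_i = if n is m.+1 then hA m x.2`_i else 0.
Proof. by case: n => [|n]; rewrite ?coef0 // coef_map. Qed.

Lemma pextP (x y : P) : (forall i, x.1`_i = y.1`_i) -> (forall i, x.2`_i = y.2`_i) -> x = y.
Proof. by case: x y => p q [r s] /= /polyP -> /polyP ->. Qed.

Lemma pext_hc_linear n : linear (pext_hc n).
Proof.
move=> a x y; apply: pextP => i.
  by rewrite !(coefD, coef_map, coefK) /= linearP.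
rewrite coefD coefK !coef_pext_hc2 coefD coefK.
by case: n => [|n]; rewrite ?scaler0 ?addr0 // linearP.
Qed.
HB.instance Definition _ n :=
  GRing.isLinear.Build K P P _ (pext_hc n) (pext_hc_linear n).

Lemma pext_hcK i j x : pext_hc i (pext_hc j x) = if i == j then pext_hc j x else 0.
Proof.
apply: pextP => k; first by rewrite !coef_map /= hcompK; case: eqP; rewrite ?coef_map ?coef0.
rewrite coef_pext_hc2; case: i j => [|i] [|j]; rewrite ?coef_pext_hc2 ?coef0 //=.
  by rewrite linear0.
by rewrite hcompK eqSS; case: eqP; rewrite ?coef_pext_hc2 ?coef0.
Qed.

Lemma poly_hc_bound (p : {poly A}) :
  exists N, forall i k, (N <= i)%N -> hA i p`_k = 0.
Proof.
elim/poly_ind: p => [|p c [N hN]]; first by exists 0 => i k _; rewrite coef0 linear0.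
have [M hM] := hcomp_bound (gca_grading A) c.
exists (maxn N M) => i k; rewrite geq_max => /andP[/hN {}hN /hM {}hM].
by rewrite coefD coefMX coefC; case: eqP; rewrite linearD /= ?hN ?hM ?linear0 ?addr0.
Qed.

Lemma pext_hc_sum x : exists N, x = \sum_(i < N) pext_hc i x.
Proof.
have [[N hN] [M hM]] := (poly_hc_bound x.1, poly_hc_bound x.2).
exists (maxn N M.+1).
have fstD (F : 'I_(maxn N M.+1) -> P) : (\sum_i F i).1 = \sum_i (F i).1.
  by apply: (big_morph (fun z : P => z.1)).
have sndD (F : 'I_(maxn N M.+1) -> P) : (\sum_i F i).2 = \sum_i (F i).2.
  by apply: (big_morph (fun z : P => z.2)).
apply: pextP => k.
  rewrite fstD coef_sum [LHS](@hcomp_sumE _ _ (gca_grading A) _ (maxn N M.+1)).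
    by apply: eq_bigr => i _; rewrite coef_map.
  by move=> i; rewrite geq_max => /andP[/hN].
rewrite sndD coef_sum; move: (maxn N M.+1) (leq_maxr N M.+1) => [//|m] Mm.
rewrite big_ord_recl coef_pext_hc2 add0r [LHS](@hcomp_sumE _ _ (gca_grading A) _ m).
  by apply: eq_bigr => i _; rewrite coef_pext_hc2.
by move=> i mi; apply: hM; apply: leq_trans mi.
Qed.

Definition pext_grading : grading P := Grading pext_hcK pext_hc_sum.

Lemma pext_homogP n (x : P) : x \in homog_of pext_grading n <->
  (forall i, x.1`_i \in homog A n) /\
  (forall i, if n is m.+1 then x.2`_i \in homog A m else x.2`_i = 0).
Proof.
split=> [/homogP <-|[h1 h2]].
  split=> i; first by rewrite coef_map; exact: homog_hcomp.
  by rewrite coef_pext_hc2; case: n => // n; exact: homog_hcomp.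
apply/homogP; apply: pextP => i; first by rewrite coef_map; exact/homogP.
by rewrite coef_pext_hc2; case: n h1 h2 => [|n] _ /(_ i) => [->//|]; move/homogP.
Qed.

Lemma pext_gr_one : 1 \in homog_of pext_grading 0.
Proof.
apply/pext_homogP; split=> i; last by rewrite coef0.
rewrite coef1; case: eqP => _; [exact: gca_one | exact: rpred0].
Qed.

Lemma homog_coef_par n (p : {poly A}) i : p`_i \in homog A n -> p^par`_i = (-1) ^+ n *: p`_i.
Proof. by move=> hp; rewrite coef_map /= (par_homog hp). Qed.

Lemma pext_gr_mul i j (x y : P) : x \in homog_of pext_grading i ->
  y \in homog_of pext_grading j -> x * y \in homog_of pext_grading (i + j).
Proof.
move=> /pext_homogP[x1 x2] /pext_homogP[y1 y2]; apply/pext_homogP.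
split=> k; first by rewrite coefM; apply: rpred_sum => l _; exact: gca_mul.
have -> : (x * y).2`_k = \sum_(l < k.+1) (x.1`_l * y.2`_(k - l) +
    x.2`_l * ((-1) ^+ j *: y.1`_(k - l))).
  rewrite coefD !coefM -big_split; apply: eq_bigr => l _.
  by rewrite (homog_coef_par (y1 _)).
case: i j x1 x2 y1 y2 => [|i] [|j] x1 x2 y1 y2.
- by rewrite big1 // => l _; rewrite x2 y2 mulr0 mul0r addr0.
- rewrite add0n; apply: rpred_sum => l _; rewrite x2 mul0r addr0; exact: (@gca_mul _ A 0).
- rewrite addSn; apply: rpred_sum => l _; rewrite y2 mulr0 add0r scale1r; exact: gca_mul.
rewrite addSn; apply: rpred_sum => l _; apply: rpredD.
  by rewrite addnS -addSn; exact: gca_mul.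
by apply: gca_mul => //; apply: rpredZ.
Qed.

Lemma sgnZ (n : nat) (a b : A) : (-1) ^+ n * (a * b) = (-1) ^+ n *: (a * b).
Proof. by rewrite -signr_odd -[in RHS]signr_odd; case: odd; rewrite ?mulN1r ?scaleN1r ?mul1r ?scale1r. Qed.

Lemma pext_gr_comm i j (x y : P) : x \in homog_of pext_grading i ->
  y \in homog_of pext_grading j -> x * y = (-1) ^+ (i * j) * (y * x).
Proof.
move=> /pext_homogP[x1 x2] /pext_homogP[y1 y2].
have -> : (-1) ^+ (i * j) * (y * x) = (-1 : K) ^+ (i * j) *: (y * x).
  by rewrite -signr_odd -[in RHS]signr_odd; case: odd;
    rewrite ?expr0 ?expr1 ?mulN1r ?scaleN1r ?mul1r ?scale1r.
apply: pextP => k.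
  rewrite coefK coefM coefMr scaler_sumr; apply: eq_bigr => l _.
  by rewrite (gca_comm (x1 _) (y1 _)) sgnZ.
have E (u v : P) a b : (forall i, u.1`_i \in homog A a) -> (forall i, v.1`_i \in homog A b) ->
  (u * v).2`_k = \sum_(l < k.+1) (u.1`_l * v.2`_(k - l) + u.2`_l * ((-1) ^+ b *: v.1`_(k - l))).
  move=> _ v1; rewrite coefD !coefM -big_split; apply: eq_bigr => l _.
  by rewrite (homog_coef_par (v1 _)).
have E' (u v : P) a b : (forall i, u.1`_i \in homog A a) -> (forall i, v.1`_i \in homog A b) ->
  (u * v).2`_k = \sum_(l < k.+1) (u.1`_(k - l) * v.2`_l + u.2`_(k - l) * ((-1) ^+ b *: v.1`_l)).
  move=> _ v1; rewrite coefD !coefMr -big_split; apply: eq_bigr => l _.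
  by rewrite (homog_coef_par (v1 _)).
rewrite coefK (E _ _ _ _ x1 y1) (E' _ _ _ _ y1 x1) scaler_sumr; apply: eq_bigr => l _.
rewrite addrC scalerDr; congr (_ + _).
  rewrite -scalerAr; case: i x1 x2 => [|i] x1 x2; first by rewrite x2 mul0r mulr0 !scaler0.
  rewrite (gca_comm (x2 _) (y1 _)) sgnZ scalerA mulSn exprD.
  by congr (_ *: _).
rewrite -scalerAr scalerA; case: j y1 y2 => [|j] y1 y2; first by rewrite y2 mul0r mulr0 !scaler0.
rewrite (gca_comm (x1 _) (y2 _)) sgnZ mulnS [(i + _)%N]addnC exprD -mulrA -expr2 sqrr_sign mulr1.
by [].
Qed.

Definition pext_gca : gca K := GCA pext_gr_one pext_gr_mul pext_gr_comm.

(* d(a t^k) = da t^k + (-1)^|a| k a t^(k-1) dt and d(a t^k dt) = da t^k dt *)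
Definition pext_dif (x : pext_gca) : pext_gca := (x.1^dif, (x.1^par)^`() + x.2^dif).

Lemma pext_dif_linear : linear pext_dif.
Proof.
move=> a x y; apply: pextP => i; first by rewrite !(coefD, coef_map, coefK) /= linearP.
rewrite !(coefD, coef_map, coefK, coef_deriv) /= !linearP /= mulrnDl scalerDr addrACA.
by rewrite -scalerMnr.
Qed.
HB.instance Definition _ :=
  GRing.isLinear.Build K pext_gca pext_gca _ pext_dif pext_dif_linear.

Lemma pext_dif_homog n x : x \in homog pext_gca n -> pext_dif x \in homog pext_gca n.+1.
Proof.
move=> /pext_homogP[x1 x2]; apply/pext_homogP; split=> i.
  by rewrite coef_map; exact: dif_homog.
rewrite coefD coef_deriv (homog_coef_par (x1 _)) coef_map; apply: rpredD.
  by apply: rpredMn; apply: rpredZ.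
case: n x1 x2 => [|n] _ x2; last exact: dif_homog.
by rewrite /= x2 raddf0 rpred0.
Qed.

Lemma pext_dif_dif x : pext_dif (pext_dif x) = 0.
Proof.
apply: pextP => i; first by rewrite !coef_map /= dif_dif coef0.
rewrite !(coefD, coef_map, coef_deriv) /= linearD /= dif_dif addr0 linearMn /=.
by rewrite dif_par mulNrn subrr coef0.
Qed.

Lemma dif_polyM (p q : {poly A}) : (p * q)^dif = p^dif * q + p^par * q^dif.
Proof.
apply/polyP => i; rewrite coef_map coefD !coefM /= linear_sum -big_split /=.
by apply: eq_bigr => j _; rewrite !coef_map /= dif_mul.
Qed.
Lemma dif_polyP (p : {poly A}) : p^par^dif = - p^dif^par.
Proof. by apply/polyP => i; rewrite coefN !coef_map /= dif_par. Qed.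

Lemma pext_dif_leibniz i x y : x \in homog pext_gca i ->
  pext_dif (x * y) = pext_dif x * y + (-1) ^+ i * (x * pext_dif y).
Proof.
move=> hx.
have -> : (-1) ^+ i * (x * pext_dif y) = ((x.1^par, - x.2^par) : pext_gca) * pext_dif y.
  have [x1 x2] := (pext_homogP _ _).1 hx.
  have -> : ((x.1^par, - x.2^par) : pext_gca) = (-1) ^+ i * x.
    have -> : (-1) ^+ i * x = (-1 : K) ^+ i *: x.
      by rewrite -signr_odd -[in RHS]signr_odd; case: odd;
         rewrite ?expr0 ?expr1 ?mulN1r ?scaleN1r ?mul1r ?scale1r.
    apply: pextP => k; rewrite coefK ?coefN; first by rewrite (homog_coef_par (x1 _)).
    case: i {hx} x1 x2 => [|i] _ x2; rewrite /= ?coefN.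
      by rewrite coef_map /= !x2 raddf0 scaler0 oppr0.
    by rewrite (homog_coef_par (x2 _)) exprS mulN1r scaleNr.
  by rewrite mulrA.
congr (_, _); rewrite /= ?dif_polyM //.
rewrite !raddfD /= !dif_polyM rmorphM derivM dif_polyP /=.
rewrite !mulrDl !mulrDr mulrN mulNr.
set a := (_ * _); set b := (x.1^par * _); set c := (_ * y.2); set d := (_ * _^dif).
set e := (x.2^dif * _); set f := (x.2^par * _).
by rewrite (addrACA c) (addrACA a) (addrCA a) (addrA b).
Qed.

Definition pext : cdga K := CDGA pext_dif_homog pext_dif_dif pext_dif_leibniz.

End Pext.

(* The base field as a cdga concentrated in degree 0. *)
Section Ground.
Variable K : fieldType.

Definition ground_hc (n : nat) (x : K^o) : K^o := if n == 0 then x else 0.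
Lemma ground_hc_linear n : linear (ground_hc n).
Proof. by move=> a x y; rewrite /ground_hc; case: eqP; rewrite ?scaler0 ?addr0. Qed.
HB.instance Definition _ n :=
  GRing.isLinear.Build K K^o K^o _ (ground_hc n) (ground_hc_linear n).
Lemma ground_hcK i j x : ground_hc i (ground_hc j x) = if i == j then ground_hc j x else 0.
Proof. by rewrite /ground_hc; case: i j => [|i] [|j] //=; case: eqP. Qed.
Lemma ground_hc_sum x : exists N, x = \sum_(i < N) ground_hc i x.
Proof. by exists 1; rewrite big_ord1. Qed.
Definition ground_grading : grading K^o := Grading ground_hcK ground_hc_sum.

Lemma ground_homogP n x : x \in homog_of ground_grading n -> n = 0 \/ x = 0.
Proof. by move/homogP; rewrite /= /ground_hc; case: eqP; [left|right]. Qed.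

Lemma ground_one : 1 \in homog_of ground_grading 0.
Proof. exact/homogP. Qed.
Lemma ground_mul i j x y : x \in homog_of ground_grading i ->
  y \in homog_of ground_grading j -> x * y \in homog_of ground_grading (i + j).
Proof.
move=> /ground_homogP[->|->]; last by rewrite mul0r rpred0.
by move=> /ground_homogP[->|->]; [exact/homogP | rewrite mulr0 rpred0].
Qed.
Lemma ground_comm i j x y : x \in homog_of ground_grading i ->
  y \in homog_of ground_grading j -> x * y = (-1) ^+ (i * j) * (y * x).
Proof.
move=> /ground_homogP[->|->]; last by rewrite mulr0 mul0r mulr0.
by rewrite mul0n mul1r mulrC.
Qed.
Definition ground_gca : gca K := GCA ground_one ground_mul ground_comm.

Definition ground_dif (x : ground_gca) : ground_gca := 0.
Lemma ground_dif_linear : linear ground_dif.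
Proof. by move=> a x y; rewrite scaler0 addr0. Qed.
HB.instance Definition _ :=
  GRing.isLinear.Build K ground_gca ground_gca _ ground_dif ground_dif_linear.
Lemma ground_dif_homog n x : x \in homog ground_gca n -> ground_dif x \in homog ground_gca n.+1.
Proof. by move=> _; exact: rpred0. Qed.
Lemma ground_dif_dif x : ground_dif (ground_dif x) = 0.
Proof. by []. Qed.
Lemma ground_dif_leibniz i (x y : ground_gca) : x \in homog ground_gca i ->
  ground_dif (x * y) = ground_dif x * y + (-1) ^+ i * (x * ground_dif y).
Proof. by move=> _; rewrite /ground_dif mul0r !mulr0 addr0. Qed.
Definition ground : cdga K := CDGA ground_dif_homog ground_dif_dif ground_dif_leibniz.

Section Unit.
Variable C : cdga K.
Definition ground_map (x : ground) : C := (x : K)%:A.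
Lemma ground_map_linear : linear ground_map.
Proof. by move=> a x y; rewrite /ground_map scalerDl -scalerA. Qed.
HB.instance Definition _ :=
  GRing.isLinear.Build K ground C _ ground_map ground_map_linear.
Lemma ground_map_monoid : monoid_morphism ground_map.
Proof.
split; first exact: scale1r.
by move=> x y; rewrite /ground_map mulr_algl scalerA.
Qed.
HB.instance Definition _ :=
  GRing.isMonoidMorphism.Build ground C ground_map ground_map_monoid.
Lemma ground_map_homog n x : x \in homog ground n -> ground_map x \in homog C n.
Proof.
move=> /ground_homogP[->|->]; last by rewrite raddf0 rpred0.
by apply: rpredZ; exact: gca_one.
Qed.
Lemma dif1 : dif C 1 = 0.
Proof.
have := dif_mul (1 : C) 1; rewrite par1 !mul1r mulr1 => /eqP.
by rewrite -subr_eq0 opprD addNKr oppr_eq0 => /eqP.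
Qed.
Lemma ground_map_dif x : ground_map (dif ground x) = dif C (ground_map x).
Proof. by rewrite [RHS]linearZ /= dif1 scaler0 /ground_map /= scale0r. Qed.
Definition ground_hom : cdga_hom ground C :=
  @CDGAHom _ ground C (@GCAHom _ ground C ground_map ground_map_homog) ground_map_dif.
End Unit.
End Ground.

(* The extension of f : A -> C to A[t,dt] with t |-> c and dt |-> dc. The numFieldType
   structure on K is used, here and below, only to have characteristic 0. *)
Section PextEval.
Variables (K : numFieldType) (A C : cdga K) (f : cdga_hom A C) (c : C).
Hypothesis c0 : c \in homog C 0.
Implicit Types p q : {poly C}.

Definition pext_eval (x : pext A) : C :=
  (map_poly f x.1).[c] + (map_poly f x.2).[c] * dif C c.

Lemma comm_c p : comm_poly p c.
Proof. by rewrite /comm_poly (mul0C _ c0). Qed.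

Lemma dc_homog : dif C c \in homog C 1.
Proof. exact: dif_homog. Qed.

Lemma dcdc : dif C c * dif C c = 0.
Proof.
have := gca_comm dc_homog dc_homog; rewrite mul1n expr1 mulN1r => /eqP.
rewrite -addr_eq0 -mulr2n -scaler_nat scaler_eq0 pnatr_eq0 /=.
by move/eqP.
Qed.

Lemma par_f x : par (f x) = f (par x).
Proof.
apply: (@homog_eq _ _ (gca_grading A) _ (@par _ C \o f) (f \o @par _ A)) => n {}x hx /=.
by rewrite (par_homog hx) (par_homog (gca_fun_homog f hx)) linearZ.
Qed.

Lemma par_horner p : par p.[c] = (map_poly (@par _ C) p).[c].
Proof.
elim/poly_ind: p => [|p a IHp]; first by rewrite rmorph0 !horner0 raddf0.
rewrite rmorphD rmorphM /= map_polyX map_polyC !hornerMXaddC raddfD /= parM IHp.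
by rewrite (par_homog c0) scale1r.
Qed.

Lemma dif_horner p : dif C p.[c] =
  (map_poly (dif C) p).[c] + (map_poly (@par _ C) p)^`().[c] * dif C c.
Proof.
elim/poly_ind: p => [|p a IHp].
  by rewrite !raddf0 !horner0 !raddf0 mul0r addr0.
have -> : map_poly (dif C) (p * 'X + a%:P) = map_poly (dif C) p * 'X + (dif C a)%:P.
  apply/polyP => i; rewrite !(coef_map, coefD, coefMX, coefC) /= linearD /=.
  by case: eqP; rewrite ?raddf0.
rewrite rmorphD rmorphM /= map_polyX map_polyC /= derivMXaddC !hornerMXaddC.
rewrite hornerD hornerMX raddfD /= dif_mul IHp par_horner !mulrDl.
rewrite -!addrA; congr (_ + _); rewrite -mulrA -(mul0C _ c0) mulrA addrCA.
by rewrite mulrA (mul0C _ c0) addrA addrC.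
Qed.

Lemma pext_eval_linear : linear pext_eval.
Proof.
move=> a x y; rewrite /pext_eval.
have E (p q : {poly A}) : (map_poly f (a%:A *: p + q)).[c] =
    a *: (map_poly f p).[c] + (map_poly f q).[c].
  rewrite rmorphD hornerD /=; congr (_ + _).
  have -> : map_poly f (a%:A *: p) = a%:A *: map_poly f p.
    by apply/polyP => i; rewrite !(coef_map, coefZ) /= !mulr_algl linearZ.
  by rewrite hornerZ mulr_algl.
by rewrite /= !E mulrDl scalerDr -scalerAl addrACA.
Qed.
HB.instance Definition _ :=
  GRing.isLinear.Build K (pext A) C _ pext_eval pext_eval_linear.

Lemma pext_eval_monoid : monoid_morphism pext_eval.
Proof.
split=> [|x y]; first by rewrite /pext_eval /= rmorph1 hornerC raddf0 horner0 mul0r addr0.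
rewrite /pext_eval /= rmorphD !rmorphM /= hornerD !(hornerM_comm _ (comm_c _)).
set p := map_poly f x.1; set q := map_poly f x.2.
set p' := map_poly f y.1; set q' := map_poly f y.2.
have -> : map_poly f (map_poly (@par _ A) y.1) = map_poly (@par _ C) p'.
  by apply/polyP => i; rewrite !coef_map /= par_f.
rewrite -par_horner !mulrDl !mulrDr -!mulrA (mul_parC1 _ dc_homog).
rewrite -!addrA; congr (_ + (_ + _)).
by rewrite (mulrA (dif C c)) (mul_parC1 _ dc_homog) -mulrA dcdc !mulr0 addr0.
Qed.
HB.instance Definition _ :=
  GRing.isMonoidMorphism.Build (pext A) C pext_eval pext_eval_monoid.

Lemma c_exp i : c ^+ i \in homog C 0.
Proof.
elim: i => [|i IHi]; first exact: gca_one.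
by rewrite exprS; exact: (gca_mul c0 IHi).
Qed.

Lemma horner_homog n p : (forall i, p`_i \in homog C n) -> p.[c] \in homog C n.
Proof.
move=> hp; rewrite horner_coef; apply: rpred_sum => i _.
by rewrite -[n]addn0; apply: gca_mul (c_exp i).
Qed.

Lemma pext_eval_homog n x : x \in homog (pext A) n -> pext_eval x \in homog C n.
Proof.
move=> /pext_homogP[x1 x2]; apply: rpredD.
  by apply: horner_homog => i; rewrite coef_map; exact: gca_fun_homog.
case: n x1 x2 => [|n] _ x2.
  have -> : x.2 = 0 by apply/polyP => i; rewrite x2 coef0.
  by rewrite raddf0 horner0 mul0r rpred0.
rewrite -addn1; apply: gca_mul dc_homog; apply: horner_homog => i.
by rewrite coef_map; exact: gca_fun_homog.
Qed.

Lemma pext_eval_dif x : pext_eval (dif (pext A) x) = dif C (pext_eval x).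
Proof.
rewrite /pext_eval [RHS]raddfD /= dif_mul dif_dif mulr0 addr0 !dif_horner.
rewrite mulrDl -mulrA dcdc mulr0 addr0 rmorphD hornerD mulrDl -!addrA /=.
have E (p : {poly A}) : map_poly f (map_poly (dif A) p) = map_poly (dif C) (map_poly f p).
  by apply/polyP => i; rewrite !coef_map /= cdga_fun_dif.
rewrite !E -deriv_map; congr (_ + (_^`().[c] * _ + _)).
by apply/polyP => i; rewrite !coef_map /= par_f.
Qed.

Definition pext_hom : cdga_hom (pext A) C :=
  @CDGAHom _ (pext A) C (@GCAHom _ (pext A) C pext_eval pext_eval_homog) pext_eval_dif.

End PextEval.

(* Polynomial forms on the standard n-simplex: the quotient of
   K[t_0..t_n] (x) /\(dt_0..dt_n) by the relations t_0 + .. + t_n = 1 and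
   dt_0 + .. + dt_n = 0 is identified with K[t_0..t_(n-1)] (x) /\(dt_0..dt_(n-1)). *)
Fixpoint apl (K : fieldType) (n : nat) : cdga K :=
  if n is m.+1 then pext (apl K m) else ground K.

Fixpoint apl_var (K : fieldType) (n k : nat) : apl K n :=
  match n with
  | 0 => 0
  | m.+1 => if k == m then ('X, 0) else ((apl_var K m k)%:P, 0)
  end.

Lemma apl_var_homog (K : fieldType) n k : apl_var K n k \in homog (apl K n) 0.
Proof.
elim: n => [|n IHn] /=; first exact: rpred0.
case: eqP => _; apply/pext_homogP; split=> i; rewrite ?coef0 //=.
  rewrite coefX; case: eqP => _; [exact: gca_one | exact: rpred0].
by rewrite coefC; case: eqP => _ //; exact: rpred0.
Qed.

(* The barycentric coordinates t_0, .., t_n. *)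
Definition apl_bary (K : fieldType) (n : nat) (j : 'I_n.+1) : apl K n :=
  if (j < n)%N then apl_var K n j else 1 - \sum_(k < n) apl_var K n k.

Lemma apl_bary_homog (K : fieldType) n (j : 'I_n.+1) : apl_bary K j \in homog (apl K n) 0.
Proof.
rewrite /apl_bary; case: ifP => _; first exact: apl_var_homog.
apply: rpredB; first exact: gca_one.
by apply: rpred_sum => k _; exact: apl_var_homog.
Qed.


(* The cdga map determined by t_k |-> c k. *)
Fixpoint apl_eval (K : numFieldType) (n : nat) (C : cdga K) (c : nat -> C)
    (hc : forall k, c k \in homog C 0) : cdga_hom (apl K n) C :=
  match n with
  | 0 => ground_hom C
  | m.+1 => pext_hom (apl_eval m hc) (hc m)
  end.

Definition bary_pull (K : fieldType) m n (phi : 'I_m.+1 -> 'I_n.+1) (k : nat) :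
  apl K m := \sum_(i | phi i == k :> nat) apl_bary K i.

Lemma bary_pull_homog (K : fieldType) m n (phi : 'I_m.+1 -> 'I_n.+1) k :
  bary_pull K phi k \in homog (apl K m) 0.
Proof. by apply: rpred_sum => i _; exact: apl_bary_homog. Qed.

(* Pullback of forms along the affine map sending vertex i to vertex phi i. *)
Definition apl_pull (K : numFieldType) m n (phi : 'I_m.+1 -> 'I_n.+1) :
    cdga_hom (apl K n) (apl K m) := apl_eval n (bary_pull_homog K phi).

Lemma apl_eval_var (K : numFieldType) n (C : cdga K) c hc k : (k < n)%N ->
  @apl_eval K n C c hc (apl_var K n k) = c k.
Proof.
elim: n => [//|n IHn]; rewrite ltnS => kn /=.
case: eqP => [->|/eqP kn']; rewrite /pext_eval /=.
  by rewrite raddf0 horner0 mul0r addr0 map_polyX hornerX.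
by rewrite raddf0 horner0 mul0r addr0 map_polyC hornerC /= IHn // ltn_neqAle kn' kn.
Qed.

Lemma sum_bary (K : fieldType) n : \sum_j apl_bary K (j : 'I_n.+1) = 1.
Proof.
rewrite big_ord_recr /= {2}/apl_bary ltnn.
under eq_bigr => i _ do rewrite /apl_bary /= ltn_ord.
by rewrite addrC subrK.
Qed.

Lemma apl_pull_bary (K : numFieldType) m n (phi : 'I_m.+1 -> 'I_n.+1) j :
  apl_pull K phi (apl_bary K j) = \sum_(i | phi i == j) apl_bary K i.
Proof.
have [jn|] := ltnP j n; first by rewrite /apl_bary jn /apl_pull apl_eval_var.
rewrite leq_eqVlt ltnNge -ltnS ltn_ord orbF => /eqP nj.
have -> : j = ord_max by apply: val_inj.
rewrite {1}/apl_bary ltnn [LHS]raddfB /= [X in X - _]rmorph1 [X in _ - X]raddf_sum /=.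
rewrite -(sum_bary K m) (partition_big phi xpredT) //= big_ord_recr /= addrAC.
rewrite [X in X + _](_ : _ = 0) ?add0r //; apply/eqP; rewrite subr_eq0; apply/eqP.
by apply: eq_bigr => k _; rewrite apl_eval_var.
Qed.

Definition std_simplex (R : realType) (n : nat) : set 'rV[R]_n.+1 :=
  [set x | (forall j, 0 <= x 0 j) /\ \sum_j x 0 j = 1].

Arguments std_simplex : clear implicits.

Section Simplex.
Variables (R : realType) (m n : nat) (phi : 'I_m.+1 -> 'I_n.+1).

Definition push_row (x : 'rV[R]_m.+1) : 'rV[R]_n.+1 :=
  \row_j \sum_(i | phi i == j) x 0 i.

Lemma push_row_simplex x : std_simplex R m x -> std_simplex R n (push_row x).
Proof.
move=> [x0 x1]; split=> [j|]; first by rewrite mxE sumr_ge0.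
under eq_bigr do rewrite mxE.
by rewrite -x1 [RHS](partition_big phi xpredT).
Qed.

Lemma push_row_continuous : continuous push_row.
Proof.
move=> x A [P Px PA].
have cj j : {for x, continuous (fun y : 'rV[R]_m.+1 => push_row y 0 j)}.
  have -> : (fun y : 'rV[R]_m.+1 => push_row y 0 j) = 
     (fun y => \sum_(i | phi i == j) y 0 i) by apply/funext => y; rewrite mxE.
  have H : continuous (fun y : 'rV[R]_m.+1 => \sum_(i | phi i == j) y 0 i).
    by apply: continuous_big => [|i _]; [exact: add_continuous | exact: coord_continuous].
  exact: H.
have FF : Filter (nbhs x) by exact: nbhs_filter.
have : \forall y \near x, forall j, P 0 j (push_row y 0 j).
  by apply: (@filter_forall _ _ _ _ FF) => j; exact: (cj j _ (Px 0 j)).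
by rewrite nbhs_simpl /=; apply: filterS => y Py; apply: PA => i j; rewrite ord1.
Qed.

Definition push_simplex (x : set_type (std_simplex R m)) :
  set_type (std_simplex R n) := 
  exist (fun y => y \in std_simplex R n) _ (mem_set (push_row_simplex (set_valP x))).

Lemma push_simplex_continuous : continuous push_simplex.
Proof.
apply: continuous_comp_initial => x.
apply: (@continuous_comp _ _ _ set_val push_row); last exact: push_row_continuous.
exact: initial_continuous.
Qed.
End Simplex.

Section Omega.
Variables (R : realType) (K : numFieldType) (X : ptopologicalType).

Definition sing (n : nat) := continuousType (set_type (std_simplex R n)) X.

Definition sing_pull m n (phi : 'I_m.+1 -> 'I_n.+1) (s : sing n) : sing m :=
  s \o mkcts (@push_simplex_continuous R m n phi).

(* A polynomial form on X assigns to each singular simplex a polynomial form on the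
   standard simplex, compatibly with the simplicial structure. *)
Definition pl_compat (w : forall n, sing n -> apl K n) : Prop :=
  forall m n (phi : 'I_m.+1 -> 'I_n.+1), {homo phi : i j / (i <= j)%N} ->
  forall s : sing n, w m (sing_pull phi s) = apl_pull K phi (w n s).

(* The cdga of forms is the direct sum, not the product, of its degree i parts. *)
Definition pl_bounded (w : forall n, sing n -> apl K n) : Prop :=
  exists N, forall i n (s : sing n), (N <= i)%N -> hcomp (gca_grading (apl K n)) i (w n s) = 0.

Record pl_form := PLForm {
  pl_val : forall n, sing n -> apl K n;
  pl_valP : pl_compat pl_val;
  pl_bdd : pl_bounded pl_val }.

HB.instance Definition _ := gen_eqMixin pl_form.
HB.instance Definition _ := gen_choiceMixin pl_form.

Lemma pl_form_eq (v w : pl_form) : (forall n s, @pl_val v n s = @pl_val w n s) -> v = w.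
Proof.
case: v w => [v vP vb] [w wP wb] /= vw.
have E : v = w by apply: functional_extensionality_dep => n; apply/funext.
by subst w; congr PLForm; exact: Prop_irrelevance.
Qed.

Program Definition pl_zero : pl_form := @PLForm (fun n _ => 0) _ _.
Next Obligation. by move=> m n phi _ s; rewrite raddf0. Qed.
Next Obligation. by exists 0 => i n s _; rewrite raddf0. Qed.

Program Definition pl_opp (v : pl_form) : pl_form :=
  @PLForm (fun n s => - pl_val v s) _ _.
Next Obligation. by move=> v m n phi hphi s; rewrite (pl_valP v hphi) raddfN. Qed.
Next Obligation.
by move=> v; have [N hN] := pl_bdd v; exists N => i n s Ni; rewrite raddfN /= hN ?oppr0.
Qed.

Program Definition pl_add (v w : pl_form) : pl_form :=
  @PLForm (fun n s => pl_val v s + pl_val w s) _ _.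
Next Obligation.
by move=> v w m n phi hphi s; rewrite (pl_valP v hphi) (pl_valP w hphi) raddfD.
Qed.
Next Obligation.
move=> v w; have [[N hN] [M hM]] := (pl_bdd v, pl_bdd w).
exists (maxn N M) => i n s; rewrite geq_max raddfD /= => /andP[Ni Mi].
by rewrite hN // hM // addr0.
Qed.

Program Definition pl_scale (a : K) (v : pl_form) : pl_form :=
  @PLForm (fun n s => a *: pl_val v s) _ _.
Next Obligation. by move=> a v m n phi hphi s; rewrite (pl_valP v hphi) linearZ. Qed.
Next Obligation.
by move=> a v; have [N hN] := pl_bdd v; exists N => i n s Ni; rewrite linearZ /= hN ?scaler0.
Qed.

Program Definition pl_one : pl_form := @PLForm (fun n _ => 1) _ _.
Next Obligation. by move=> m n phi _ s; rewrite rmorph1. Qed.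
Next Obligation.
exists 1 => i n s i1; rewrite (hcomp_homog i (gca_one (apl K n))).
by case: i i1.
Qed.

Lemma hc_mul (A : gca K) N M i (x y : A) :
  (forall i, (N <= i)%N -> hcomp (gca_grading A) i x = 0) ->
  (forall i, (M <= i)%N -> hcomp (gca_grading A) i y = 0) ->
  (N + M <= i)%N -> hcomp (gca_grading A) i (x * y) = 0.
Proof.
move=> hN hM NMi; rewrite (hcomp_sumE hN) (hcomp_sumE hM) mulr_suml raddf_sum big1 //= => j _.
rewrite mulr_sumr raddf_sum big1 //= => k _.
rewrite (hcomp_homog _ (gca_mul (homog_hcomp _ _ _) (homog_hcomp _ _ _))) gtn_eqF //.
by apply: leq_trans NMi; rewrite -addSn leq_add // ltnW.
Qed.

Program Definition pl_mul (v w : pl_form) : pl_form :=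
  @PLForm (fun n s => pl_val v s * pl_val w s) _ _.
Next Obligation.
by move=> v w m n phi hphi s; rewrite (pl_valP v hphi) (pl_valP w hphi) rmorphM.
Qed.
Next Obligation.
move=> v w; have [[N hN] [M hM]] := (pl_bdd v, pl_bdd w).
by exists (N + M) => i n s; apply: hc_mul => j Nj; [exact: hN | exact: hM].
Qed.

Program Definition pl_dif (v : pl_form) : pl_form :=
  @PLForm (fun n s => dif (apl K n) (pl_val v s)) _ _.
Next Obligation. by move=> v m n phi hphi s; rewrite (pl_valP v hphi) cdga_fun_dif. Qed.
Next Obligation.
move=> v; have [N hN] := pl_bdd v; exists N.+1 => -[//|i] n s Ni.
by rewrite hc_dif hN // raddf0.
Qed.

Lemma hom_hcomp (A B : gca K) (f : gca_hom A B) i x :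
  hcomp (gca_grading B) i (f x) = f (hcomp (gca_grading A) i x).
Proof.
apply: (@homog_eq _ _ (gca_grading A) _ (hcomp (gca_grading B) i \o f)
  (f \o hcomp (gca_grading A) i)) => n {}x hx /=.
rewrite (hcomp_homog _ (gca_fun_homog f hx)) (hcomp_homog _ hx).
by case: eqP; rewrite ?raddf0.
Qed.

Program Definition pl_hcomp (i : nat) (v : pl_form) : pl_form :=
  @PLForm (fun n s => hcomp (gca_grading (apl K n)) i (pl_val v s)) _ _.
Next Obligation. by move=> i v m n phi hphi s; rewrite (pl_valP v hphi) hom_hcomp. Qed.
Next Obligation.
move=> i v; exists i.+1 => j n s ij.
by rewrite hcompK gtn_eqF.
Qed.

Lemma pl_addA : associative pl_add.
Proof. by move=> u v w; apply: pl_form_eq => n s /=; rewrite addrA. Qed.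
Lemma pl_addC : commutative pl_add.
Proof. by move=> u v; apply: pl_form_eq => n s /=; rewrite addrC. Qed.
Lemma pl_add0 : left_id pl_zero pl_add.
Proof. by move=> u; apply: pl_form_eq => n s /=; rewrite add0r. Qed.
Lemma pl_addN : left_inverse pl_zero pl_opp pl_add.
Proof. by move=> u; apply: pl_form_eq => n s /=; rewrite addNr. Qed.
HB.instance Definition _ := GRing.isZmodule.Build pl_form pl_addA pl_addC pl_add0 pl_addN.

Lemma pl_mulA : associative pl_mul.
Proof. by move=> u v w; apply: pl_form_eq => n s /=; rewrite mulrA. Qed.
Lemma pl_mul1 : left_id pl_one pl_mul.
Proof. by move=> u; apply: pl_form_eq => n s /=; rewrite mul1r. Qed.
Lemma pl_mulr1 : right_id pl_one pl_mul.
Proof. by move=> u; apply: pl_form_eq => n s /=; rewrite mulr1. Qed.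
Lemma pl_mulDl : left_distributive pl_mul +%R.
Proof. by move=> u v w; apply: pl_form_eq => n s /=; rewrite mulrDl. Qed.
Lemma pl_mulDr : right_distributive pl_mul +%R.
Proof. by move=> u v w; apply: pl_form_eq => n s /=; rewrite mulrDr. Qed.
Lemma pl_one_neq0 : pl_one != 0.
Proof.
have c : continuous (fun _ : set_type (std_simplex R 0) => (point : X)) by exact: cst_continuous.
apply/eqP => /(congr1 (fun w => pl_val w (mkcts c : sing 0))) /eqP /=.
by rewrite oner_eq0.
Qed.
HB.instance Definition _ := GRing.Zmodule_isNzRing.Build pl_form
  pl_mulA pl_mul1 pl_mulr1 pl_mulDl pl_mulDr pl_one_neq0.

Lemma pl_scaleA a b v : pl_scale a (pl_scale b v) = pl_scale (a * b) v.
Proof. by apply: pl_form_eq => n s /=; rewrite scalerA. Qed.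
Lemma pl_scale1 : left_id 1 pl_scale.
Proof. by move=> u; apply: pl_form_eq => n s /=; rewrite scale1r. Qed.
Lemma pl_scaleDr : right_distributive pl_scale +%R.
Proof. by move=> a u v; apply: pl_form_eq => n s /=; rewrite scalerDr. Qed.
Lemma pl_scaleDl v : {morph pl_scale^~ v : a b / a + b}.
Proof. by move=> a b; apply: pl_form_eq => n s /=; rewrite scalerDl. Qed.
HB.instance Definition _ := GRing.Zmodule_isLmodule.Build K pl_form
  pl_scaleA pl_scale1 pl_scaleDr pl_scaleDl.
Lemma pl_scaleAl (a : K) (u v : pl_form) : a *: (u * v) = (a *: u) * v.
Proof. by apply: pl_form_eq => n s /=; rewrite scalerAl. Qed.
HB.instance Definition _ := GRing.Lmodule_isLalgebra.Build K pl_form pl_scaleAl.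
Lemma pl_scaleAr (a : K) (u v : pl_form) : a *: (u * v) = u * (a *: v).
Proof. by apply: pl_form_eq => n s /=; rewrite scalerAr. Qed.
HB.instance Definition _ := GRing.Lalgebra_isAlgebra.Build K pl_form pl_scaleAr.

Lemma pl_val_sum I (r : seq I) (F : I -> pl_form) n (s : sing n) :
  pl_val (\sum_(i <- r) F i) s = \sum_(i <- r) pl_val (F i) s.
Proof. exact: (big_morph (fun v : pl_form => pl_val v s)). Qed.

Lemma pl_hcomp_linear i : linear (pl_hcomp i).
Proof. by move=> a u v; apply: pl_form_eq => n s /=; rewrite linearP. Qed.
HB.instance Definition _ i :=
  GRing.isLinear.Build K pl_form pl_form _ (pl_hcomp i) (pl_hcomp_linear i).
Lemma pl_hcompK i j v : pl_hcomp i (pl_hcomp j v) = if i == j then pl_hcomp j v else 0.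
Proof. by apply: pl_form_eq => n s /=; rewrite hcompK; case: eqP. Qed.
Lemma pl_hcomp_sum v : exists N, v = \sum_(i < N) pl_hcomp i v.
Proof.
have [N hN] := pl_bdd v; exists N; apply: pl_form_eq => n s.
by rewrite pl_val_sum; apply: hcomp_sumE => i; exact: hN.
Qed.
Definition pl_grading : grading pl_form := Grading pl_hcompK pl_hcomp_sum.

Lemma pl_homogP i (v : pl_form) : v \in homog_of pl_grading i <->
  forall n (s : sing n), pl_val v s \in homog (apl K n) i.
Proof.
split=> [/homogP <- n s|h]; first exact: homog_hcomp.
by apply/homogP/pl_form_eq => n s; apply/homogP; exact: h.
Qed.

Lemma pl_gr_one : 1 \in homog_of pl_grading 0.
Proof. by apply/pl_homogP => n s; exact: gca_one. Qed.
Lemma pl_gr_mul i j v w : v \in homog_of pl_grading i ->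
  w \in homog_of pl_grading j -> v * w \in homog_of pl_grading (i + j).
Proof. by move=> /pl_homogP hv /pl_homogP hw; apply/pl_homogP => n s; exact: (gca_mul (hv n s) (hw n s)). Qed.
Lemma pl_gr_comm i j v w : v \in homog_of pl_grading i ->
  w \in homog_of pl_grading j -> v * w = (-1) ^+ (i * j) * (w * v).
Proof.
move=> /pl_homogP hv /pl_homogP hw; apply: pl_form_eq => n s.
rewrite /= (gca_comm (hv n s) (hw n s)).
by rewrite -signr_odd -[in RHS]signr_odd; case: odd; rewrite ?mulN1r ?mul1r.
Qed.
Definition pl_gca : gca K := GCA pl_gr_one pl_gr_mul pl_gr_comm.

Definition Omega_dif : pl_gca -> pl_gca := pl_dif.
Lemma pl_dif_linear : linear Omega_dif.
Proof. by move=> a u v; apply: pl_form_eq => n s /=; rewrite linearP. Qed.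
HB.instance Definition _ :=
  GRing.isLinear.Build K pl_gca pl_gca _ Omega_dif pl_dif_linear.
Lemma pl_dif_homog n v : v \in homog pl_gca n -> Omega_dif v \in homog pl_gca n.+1.
Proof. by move=> /pl_homogP hv; apply/pl_homogP => m s; exact: dif_homog. Qed.
Lemma pl_dif_dif v : Omega_dif (Omega_dif v) = 0.
Proof. by apply: pl_form_eq => n s /=; rewrite dif_dif. Qed.
Lemma pl_dif_leibniz i (v w : pl_gca) : v \in homog pl_gca i ->
  Omega_dif (v * w) = Omega_dif v * w + (-1) ^+ i * (v * Omega_dif w).
Proof.
move=> /pl_homogP hv; apply: pl_form_eq => n s.
rewrite /= (dif_leibniz _ (hv n s)).
by rewrite -signr_odd -[in RHS]signr_odd; case: odd; rewrite ?mulN1r ?mul1r.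
Qed.

Definition Omega : cdga K := CDGA pl_dif_homog pl_dif_dif pl_dif_leibniz.
End Omega.

Definition finite_dim (K : fieldType) (V : lmodType K) : Prop :=
  exists n (e : 'I_n -> V), forall v, exists c : 'I_n -> K, v = \sum_i c i *: e i.

Section Cohomology.
Variables (K : fieldType) (A : cdga K) (n : nat).

HB.instance Definition _ := GRing.SubmodClosed.on (homog A n).
Definition degree_part := {x : A | x \in homog A n}.
HB.instance Definition _ := Choice.on degree_part.
HB.instance Definition _ := SubType.on degree_part.
HB.instance Definition _ := [SubChoice_isSubLmodule of degree_part by <:].

Definition cocycle : {pred A} := [pred x | (x \in homog A n) && (dif A x == 0)].
Lemma cocycle_submod : submod_closed cocycle.
Proof.
split=> [|a x y /andP[hx /eqP dx] /andP[hy /eqP dy]]; apply/andP; split.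
- exact: rpred0.
- by rewrite raddf0.
- by apply: rpredD => //; apply: rpredZ.
- by rewrite linearP /= dx dy scaler0 addr0.
Qed.
HB.instance Definition _ := GRing.isSubmodClosed.Build K A cocycle cocycle_submod.

Definition Zspace := {x : A | x \in cocycle}.
HB.instance Definition _ := Choice.on Zspace.
HB.instance Definition _ := SubType.on Zspace.
HB.instance Definition _ := [SubChoice_isSubLmodule of Zspace by <:].

(* No degree is required of y: if val z = dif A y has degree n > 0, then it is also
   the differential of the component of y of degree n - 1, and if n = 0 then it is 0. *)
Definition coboundary : {pred Zspace} :=
  [pred z : Zspace | `[< exists y : A, val z = dif A y >]].
Lemma coboundary_submod : submod_closed coboundary.
Proof.
split=> [|a x y /asboolP[u hu] /asboolP[v hv]]; apply/asboolP.
  by exists 0; rewrite !raddf0.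
by exists (a *: u + v); rewrite !linearP /= hu hv.
Qed.
HB.instance Definition _ :=
  GRing.isSubmodClosed.Build K Zspace coboundary coboundary_submod.

Definition cohomology := Quotient.quot coboundary.
HB.instance Definition _ := EqQuotient.on cohomology.
HB.instance Definition _ := GRing.Zmodule.on cohomology.

Definition cohclass (z : Zspace) : cohomology := (\pi_cohomology z)%qT.

Lemma cohclassE z w : cohclass z = cohclass w <-> z - w \in coboundary.
Proof.
by rewrite (Quotient.idealrBE coboundary); split=> /eqP.
Qed.

Definition coh_scale (a : K) (u : cohomology) : cohomology :=
  cohclass (a *: repr u).
Lemma coh_scaleE a z : coh_scale a (cohclass z) = cohclass (a *: z).
Proof.
apply/cohclassE; rewrite -scalerBr; apply: rpredZ; apply/cohclassE.
by rewrite /cohclass reprK.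
Qed.
Lemma cohclassD z w : cohclass (z + w) = cohclass z + cohclass w.
Proof. exact: (raddfD (\pi_(Quotient.quot coboundary))%qT). Qed.

Lemma coh_ind (P : cohomology -> Prop) : (forall z, P (cohclass z)) -> forall u, P u.
Proof. by move=> h u; rewrite -[u]reprK; exact: h. Qed.

Lemma coh_scaleA a b u : coh_scale a (coh_scale b u) = coh_scale (a * b) u.
Proof. by move: u; apply: coh_ind => z; rewrite !coh_scaleE scalerA. Qed.
Lemma coh_scale1 : left_id 1 coh_scale.
Proof. by apply: coh_ind => z; rewrite coh_scaleE scale1r. Qed.
Lemma coh_scaleDr : right_distributive coh_scale +%R.
Proof.
move=> a; apply: coh_ind => z; apply: coh_ind => w.
by rewrite -cohclassD !coh_scaleE scalerDr cohclassD.
Qed.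
Lemma coh_scaleDl u : {morph coh_scale^~ u : a b / a + b}.
Proof.
move=> a b; move: u; apply: coh_ind => z.
by rewrite !coh_scaleE scalerDl cohclassD.
Qed.
HB.instance Definition _ := GRing.Zmodule_isLmodule.Build K cohomology
  coh_scaleA coh_scale1 coh_scaleDr coh_scaleDl.
End Cohomology.

Arguments cocycle {K} A n.
Arguments coboundary {K} A n.
Arguments degree_part {K} A n.
Arguments Zspace {K} A n.
Arguments cohomology {K} A n.

Section CohMap.
Variables (K : fieldType) (A B : cdga K) (f : cdga_hom A B) (n : nat).

Lemma cocycle_map x : x \in cocycle A n -> f x \in cocycle B n.
Proof.
move=> /andP[hx /eqP dx]; apply/andP; split; first exact: gca_fun_homog.
by rewrite -cdga_fun_dif dx raddf0.
Qed.

Definition Zmap (z : Zspace A n) : Zspace B n :=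
  exist (fun x => x \in cocycle B n) (f (val z)) (cocycle_map (valP z)).

Definition coh_map (u : cohomology A n) : cohomology B n :=
  cohclass (Zmap (repr u)).

Lemma coh_mapE z : coh_map (cohclass z) = cohclass (Zmap z).
Proof.
apply/cohclassE.
have /cohclassE/asboolP[y hy] : cohclass (repr (cohclass z)) = cohclass z.
  by rewrite /cohclass reprK.
by apply/asboolP; exists (f y); rewrite -cdga_fun_dif -hy !raddfB.
Qed.
End CohMap.

Lemma coh_map_linear (K : fieldType) (A B : cdga K) (f : cdga_hom A B) n :
  linear (coh_map f (n := n)).
Proof.
move=> a; apply: coh_ind => z; apply: coh_ind => w.
rewrite -[a *: cohclass z]/(coh_scale a (cohclass z)) coh_scaleE -cohclassD !coh_mapE.
rewrite -[a *: cohclass _]/(coh_scale a (cohclass _)) coh_scaleE -cohclassD.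
by congr cohclass; apply: val_inj; rewrite /= linearP.
Qed.

Definition q_equivalence (K : fieldType) (q : nat) (A B : cdga K)
    (f : cdga_hom A B) : Prop :=
  (forall i, (i <= q)%N -> bijective (coh_map f (n := i))) /\
  injective (coh_map f (n := q.+1)).

Inductive q_type_eq (K : fieldType) (q : nat) (A : cdga K) : cdga K -> Prop :=
| qte_refl : q_type_eq q A A
| qte_forward B C (f : cdga_hom B C) :
    q_type_eq q A B -> q_equivalence q f -> q_type_eq q A C
| qte_backward B C (f : cdga_hom C B) :
    q_type_eq q A B -> q_equivalence q f -> q_type_eq q A C.

Definition connected_cdga (K : fieldType) (A : cdga K) : Prop :=
  forall x, x \in homog A 0 -> exists a : K, x = a%:A.

Definition q_finite (K : fieldType) (q : nat) (A : cdga K) : Prop :=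
  connected_cdga A /\ forall i, (i <= q)%N -> finite_dim (degree_part A i).

(* L is the free graded-commutative algebra on the direct sum of the spaces V i,
   with V i placed in degree deg i and included in L by u i. *)
Definition is_free_gca (K : fieldType) (I : Type) (deg : I -> nat)
    (V : I -> lmodType K) (L : gca K) (u : forall i, {linear V i -> L}) : Prop :=
  (forall i v, u i v \in homog L (deg i)) /\
  forall (C : gca K) (g : forall i, {linear V i -> C}),
    (forall i v, g i v \in homog C (deg i)) ->
    exists h : gca_hom L C, (forall i v, h (u i v) = g i v) /\
      forall h' : gca_hom L C, (forall i v, h' (u i v) = g i v) -> h' =1 h.

Definition bilinear_fun (K : fieldType) (U V W : lmodType K) (t : U -> V -> W) :=
  (forall u, linear (t u)) /\ (forall v, linear (t^~ v)).

(* T is the tensor product of U and V, with t u v in the role of the pure tensor. *)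
Definition is_tensor (K : fieldType) (U V T : lmodType K) (t : U -> V -> T) : Prop :=
  bilinear_fun t /\
  forall (W : lmodType K) (b : U -> V -> W), bilinear_fun b ->
    exists h : {linear T -> W}, (forall u v, h (t u v) = b u v) /\
      forall h' : {linear T -> W}, (forall u v, h' (t u v) = b u v) -> h' =1 h.

(* iota exhibits B' as a Hirsch extension B (x) /\U of degree i. Multiplication in B'
   identifies B (x) L with B', where L = /\U; since iota and lam are morphisms and B'
   is graded-commutative, the product and the grading of B' are those of the tensor
   product of graded algebras. *)
Definition hirsch_extension (K : fieldType) (i : nat) (B B' : cdga K)
    (iota : cdga_hom B B') : Prop :=
  exists (U : lmodType K) (L : gca K) (u : {linear U -> L}) (lam : gca_hom L B'),
    [/\ is_free_gca (fun _ : unit => i) (V := fun=> U) (fun=> u),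
        is_tensor (fun (b : B) (l : L) => iota b * lam l)
      & forall x, exists2 z, z \in cocycle B i.+1 & dif B' (lam (u x)) = iota z].

Definition inductive_limit (K : fieldType) (N : nat -> cdga K)
    (s : forall k, cdga_hom (N k) (N k.+1)) (M : cdga K)
    (iota : forall k, cdga_hom (N k) M) : Prop :=
  (forall k x, iota k.+1 (s k x) = iota k x) /\
  forall (C : cdga K) (f : forall k, cdga_hom (N k) C),
    (forall k x, f k.+1 (s k x) = f k x) ->
    exists h : cdga_hom M C, (forall k x, h (iota k x) = f k x) /\
      forall h' : cdga_hom M C, (forall k x, h' (iota k x) = f k x) -> h' =1 h.

(* M = (/\V, d) with V = V^1 + .. + V^q, and M is obtained from the base field N 0 0 by
   Hirsch extensions N i k -> N i k.+1 of degree i.+1, of nondecreasing degrees: in each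
   degree 1, .., q in turn there is a sequence of extensions, indexed by k, whose limit
   N i.+1 0 is the starting point for the next degree. Infinitely many extensions may
   be necessary in a single degree; trivial ones (U = 0) are allowed. *)
Definition q_minimal (K : fieldType) (q : nat) (M : cdga K) : Prop :=
  (exists (V : 'I_q -> lmodType K) (v : forall i, {linear V i -> M}),
     is_free_gca (fun i : 'I_q => i.+1) v) /\
  exists (N : nat -> nat -> cdga K)
    (s : forall i k, cdga_hom (N i k) (N i k.+1))
    (iota : forall i k, cdga_hom (N i k) (N i.+1 0)),
    [/\ forall x : N 0 0, exists a : K, x = a%:A,
        forall i k, (i < q)%N -> hirsch_extension i.+1 (s i k),
        forall i, (i < q)%N -> inductive_limit (s i) (iota i)
      & exists f : cdga_hom (N q 0) M, bijective f].

Definition is_q_minimal_model (K : fieldType) (q : nat) (M A : cdga K) : Prop :=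
  q_minimal q M /\ exists f : cdga_hom M A, q_equivalence q f.

Section Topology.
Variable R : realType.

Definition path_connected (X : topologicalType) : Prop :=
  inhabited X /\
  forall x y : X, exists g : R -> X,
    [/\ {within `[0, 1], continuous g}, g 0 = x & g 1 = y].

Definition homotopic (X Y : topologicalType) (f g : X -> Y) : Prop :=
  exists h : X * R -> Y,
    [/\ {within [set p | 0 <= p.2 <= 1], continuous h},
        forall x, h (x, 0) = f x & forall x, h (x, 1) = g x].

Definition homotopy_equivalent (X Y : topologicalType) : Prop :=
  exists (f : X -> Y) (g : Y -> X),
    [/\ continuous f, continuous g, homotopic (g \o f) idfun
      & homotopic (f \o g) idfun].

Definition disk (n : nat) : set 'rV[R]_n := [set x | \sum_i x 0 i ^+ 2 <= 1].
Definition open_disk (n : nat) : set 'rV[R]_n := [set x | \sum_i x 0 i ^+ 2 < 1].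
Definition sphere (n : nat) : set 'rV[R]_n := [set x | \sum_i x 0 i ^+ 2 = 1].

(* Whitehead's definition, with characteristic maps chr c defined on the closed
   Euclidean disk: the open cells oc c partition Y; chr c is a homeomorphism from the
   open disk onto oc c; closure-finiteness; weak topology. *)
Definition is_CW (Y : topologicalType) : Prop :=
  hausdorff_space Y /\
  exists (cell : Type) (dim : cell -> nat) (chr : forall c, 'rV[R]_(dim c) -> Y),
    let oc c := chr c @` @open_disk (dim c) in
    [/\ forall y, exists! c, oc c y,
        forall c, {within @disk (dim c), continuous (chr c)} /\
          exists g : Y -> 'rV[R]_(dim c), {within oc c, continuous g} /\
            forall x, @open_disk (dim c) x -> g (chr c x) = x,
        forall c, exists F : set cell, [/\ finite_set F,
          forall e, F e -> (dim e < dim c)%N &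
          chr c @` @sphere (dim c) `<=` \bigcup_(e in F) oc e]
      & forall S : set Y, (forall c, closed (S `&` chr c @` @disk (dim c))) -> closed S].

Definition has_CW_type (X : topologicalType) : Prop :=
  exists Y : topologicalType, is_CW Y /\ homotopy_equivalent X Y.
End Topology.

Definition is_q_model (R : realType) (q : nat) (X : ptopologicalType)
    (A : cdga R[i]) : Prop :=
  q_type_eq q A (Omega R R[i] X).

(* Main.v *)
From HB Require Import structures.
Require Import Defs.
From mathcomp Require Import all_boot all_order all_algebra.
From mathcomp Require Import all_classical all_reals all_analysis.
From mathcomp Require Import complex.

Set Implicit Arguments.
Unset Strict Implicit.
Unset Printing Implicit Defensive.

Import Order.TTheory GRing.Theory Num.Theory.

Local Open Scope ring_scope.

(** Let A be a q-finite q-model and M the q-minimal model. A zig-zag of q-equivalences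
    joins M to A, and a q-minimal cdga can be lifted backwards through any q-equivalence,
    so that the zig-zag collapses to a single q-equivalence g : M -> A
    ([q_minimal_zigzag]). As g is injective on H^i for all i <= q+1, it is enough that
    g maps M^i into a finite-dimensional subspace of A ([cohomology_finite]). For
    i <= q this holds because A^i is finite-dimensional. In degree q+1 the space A^(q+1)
    may be infinite-dimensional, but M is generated in degrees 1, .., q; hence every
    element of M^(q+1) is a sum of products of elements of lower positive degree, and g
    maps it into the span of the products A^a * A^b with a + b = q+1 and 1 <= a, b <= q
    ([top_degree_span]).

    It remains to lift a q-equivalence g : M -> C through a q-equivalence phi : B -> C. The
    usual lift is a lift up to homotopy; homotopies are avoided by replacing B with the path
    fibration of phi, the cdga F of pairs (b, x) with x in C[t,dt] and
    phi b = x at t = 0. The projection F -> B is a quasi-isomorphism by the Poincare lemma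
    for C[t,dt] ([poincare]), and evaluation at t = 1 is a q-equivalence F -> C which is
    surjective already on cochains. Through such a map g lifts strictly
    ([lift_minimal]), one Hirsch extension at a time: the differential of a generator
    u of degree i <= q lifts to a cocycle whose image is exact, and injectivity on
    H^(i+1) and surjectivity on H^i provide a value for u ([lift_cochain]). The values
    can be chosen linearly in u by Zorn's lemma ([linear_selection]), and they extend
    to the whole Hirsch extension by its universal property ([hirsch_extend]). The
    composite M -> F -> B is the required q-equivalence. *)

(** * Graded subalgebras, sub-cdgas and products *)

Record graded_subalg (K : fieldType) (A : gca K) := GradedSubalg {
  gsub_pred : {pred A};
  gsub_alg : subalg_closed gsub_pred;
  gsub_hcomp : forall n x, x \in gsub_pred -> hcomp (gca_grading A) n x \in gsub_pred }.

Section Subgca.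
Variables (K : fieldType) (A : gca K) (S : graded_subalg A).

HB.instance Definition _ :=
  GRing.isSubalgClosed.Build K A (gsub_pred S) (gsub_alg S).

Definition gsub := {x : A | x \in gsub_pred S}.
HB.instance Definition _ := Choice.on gsub.
HB.instance Definition _ := SubType.on gsub.
HB.instance Definition _ := [SubChoice_isSubAlgebra of gsub by <:].

Definition gsub_hc n (x : gsub) : gsub :=
  exist (fun y => y \in gsub_pred S) _ (gsub_hcomp n (valP x)).
Lemma gsub_hc_linear n : linear (gsub_hc n).
Proof. by move=> a x y; apply: val_inj; rewrite /= linearP. Qed.
HB.instance Definition _ n :=
  GRing.isLinear.Build K gsub gsub _ (gsub_hc n) (gsub_hc_linear n).
Lemma gsub_hcK i j x : gsub_hc i (gsub_hc j x) = if i == j then gsub_hc j x else 0.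
Proof. by apply: val_inj; rewrite /= hcompK; case: eqP. Qed.
Lemma gsub_hc_sum x : exists N, x = \sum_(i < N) gsub_hc i x.
Proof.
have [N hN] := hcomp_sum (gca_grading A) (val x).
by exists N; apply: val_inj; rewrite raddf_sum.
Qed.
Definition gsub_grading : grading gsub := Grading gsub_hcK gsub_hc_sum.

Lemma gsub_homog n (x : gsub) : (x \in homog_of gsub_grading n) = (val x \in homog A n).
Proof. exact: (inj_eq val_inj). Qed.

Lemma gsub_one : 1 \in homog_of gsub_grading 0.
Proof. by rewrite gsub_homog; exact: gca_one. Qed.
Lemma gsub_mul i j x y : x \in homog_of gsub_grading i ->
  y \in homog_of gsub_grading j -> x * y \in homog_of gsub_grading (i + j).
Proof. by rewrite !gsub_homog; exact: gca_mul. Qed.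
Lemma gsub_comm i j x y : x \in homog_of gsub_grading i ->
  y \in homog_of gsub_grading j -> x * y = (-1) ^+ (i * j) * (y * x).
Proof.
rewrite !gsub_homog => hx hy; apply: val_inj.
by rewrite [LHS](gca_comm hx hy) !rmorphM rmorphXn rmorphN1.
Qed.
Definition gsub_gca : gca K := GCA gsub_one gsub_mul gsub_comm.

Definition gsub_val : gsub_gca -> A := val.
HB.instance Definition _ := GRing.isLinear.Build K gsub_gca A _ gsub_val
  (fun _ _ _ => erefl).
HB.instance Definition _ := GRing.isMonoidMorphism.Build gsub_gca A gsub_val
  (conj erefl (fun _ _ => erefl)).
Lemma gsub_val_homog n x : x \in homog gsub_gca n -> gsub_val x \in homog A n.
Proof. by rewrite -gsub_homog. Qed.
Definition gsub_incl : gca_hom gsub_gca A := GCAHom gsub_val_homog.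

End Subgca.

Section Subcdga.
Variables (K : fieldType) (A : cdga K) (S : graded_subalg A).
Hypothesis S_dif : forall x, x \in gsub_pred S -> dif A x \in gsub_pred S.

Definition csub_dif (x : gsub_gca S) : gsub_gca S :=
  exist (fun y => y \in gsub_pred S) _ (S_dif (valP x)).
Lemma csub_dif_linear : linear csub_dif.
Proof. by move=> a x y; apply: val_inj; rewrite /= linearP. Qed.
HB.instance Definition _ :=
  GRing.isLinear.Build K (gsub_gca S) (gsub_gca S) _ csub_dif csub_dif_linear.
Lemma csub_dif_homog n x : x \in homog (gsub_gca S) n -> csub_dif x \in homog (gsub_gca S) n.+1.
Proof. by rewrite /homog !gsub_homog; exact: dif_homog. Qed.
Lemma csub_dif_dif x : csub_dif (csub_dif x) = 0.
Proof. by apply: val_inj; rewrite /= dif_dif. Qed.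
Lemma csub_dif_leibniz i (x y : gsub_gca S) : x \in homog (gsub_gca S) i ->
  csub_dif (x * y) = csub_dif x * y + (-1) ^+ i * (x * csub_dif y).
Proof.
rewrite /homog gsub_homog => hx; apply: val_inj.
rewrite [LHS](dif_leibniz _ hx) -[RHS]/(gsub_val _).
by rewrite raddfD /= !rmorphM rmorphXn rmorphN1.
Qed.
Definition csub : cdga K := CDGA csub_dif_homog csub_dif_dif csub_dif_leibniz.

Definition csub_incl : cdga_hom csub A :=
  @CDGAHom _ csub A (gsub_incl S) (fun=> erefl).
End Subcdga.

Section Product.
Variables (K : fieldType) (A B : cdga K).
Local Notation P := (A * B)%type.
Local Notation hA := (hcomp (gca_grading A)).
Local Notation hB := (hcomp (gca_grading B)).

Definition prod_hc n (x : P) : P := (hA n x.1, hB n x.2).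
Lemma prod_hc_linear n : linear (prod_hc n).
Proof. by move=> a x y; rewrite /prod_hc /= !linearP. Qed.
HB.instance Definition _ n :=
  GRing.isLinear.Build K P P _ (prod_hc n) (prod_hc_linear n).
Lemma prod_hcK i j x : prod_hc i (prod_hc j x) = if i == j then prod_hc j x else 0.
Proof. by rewrite /prod_hc /= !hcompK; case: eqP. Qed.
Lemma prod_hc_sum x : exists N, x = \sum_(i < N) prod_hc i x.
Proof.
have [[N hN] [M hM]] := (hcomp_bound (gca_grading A) x.1, hcomp_bound (gca_grading B) x.2).
exists (maxn N M); rewrite [LHS]surjective_pairing [RHS]surjective_pairing.
rewrite (raddf_sum fst) (raddf_sum snd) /=.
by congr (_, _); apply: hcomp_sumE => i; rewrite geq_max => /andP[/hN + /hM].
Qed.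
Definition prod_grading : grading P := Grading prod_hcK prod_hc_sum.

Lemma prod_homog n (x : P) :
  (x \in homog_of prod_grading n) = (x.1 \in homog A n) && (x.2 \in homog B n).
Proof. by []. Qed.

Lemma prod_one : 1 \in homog_of prod_grading 0.
Proof. by rewrite prod_homog; apply/andP; split; exact: gca_one. Qed.
Lemma prod_mul i j x y : x \in homog_of prod_grading i ->
  y \in homog_of prod_grading j -> x * y \in homog_of prod_grading (i + j).
Proof.
rewrite !prod_homog => /andP[x1 x2] /andP[y1 y2].
by apply/andP; split; exact: gca_mul.
Qed.
Lemma prod_comm i j x y : x \in homog_of prod_grading i ->
  y \in homog_of prod_grading j -> x * y = (-1) ^+ (i * j) * (y * x).
Proof.
rewrite !prod_homog => /andP[x1 x2] /andP[y1 y2].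
rewrite [RHS]surjective_pairing [LHS]surjective_pairing /=.
by rewrite (gca_comm x1 y1) (gca_comm x2 y2) !(rmorphXn fst, rmorphXn snd) !rmorphN1.
Qed.
Definition prod_gca : gca K := GCA prod_one prod_mul prod_comm.

Definition prod_dif (x : prod_gca) : prod_gca := (dif A x.1, dif B x.2).
Lemma prod_dif_linear : linear prod_dif.
Proof. by move=> a x y; rewrite /prod_dif /= !linearP. Qed.
HB.instance Definition _ :=
  GRing.isLinear.Build K prod_gca prod_gca _ prod_dif prod_dif_linear.
Lemma prod_dif_homog n x : x \in homog prod_gca n -> prod_dif x \in homog prod_gca n.+1.
Proof.
rewrite /homog !prod_homog => /andP[x1 x2].
by apply/andP; split; exact: dif_homog.
Qed.
Lemma prod_dif_dif x : prod_dif (prod_dif x) = 0.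
Proof. by rewrite /prod_dif /= !dif_dif. Qed.
Lemma prod_dif_leibniz i (x y : prod_gca) : x \in homog prod_gca i ->
  prod_dif (x * y) = prod_dif x * y + (-1) ^+ i * (x * prod_dif y).
Proof.
rewrite /homog prod_homog => /andP[x1 x2].
rewrite [RHS]surjective_pairing /= /prod_dif /= (dif_leibniz _ x1) (dif_leibniz _ x2).
by rewrite !(rmorphXn fst, rmorphXn snd) !rmorphN1.
Qed.
Definition prod_cdga : cdga K := CDGA prod_dif_homog prod_dif_dif prod_dif_leibniz.

Definition prod_fst : prod_cdga -> A := fst.
HB.instance Definition _ := GRing.isLinear.Build K prod_cdga A _ prod_fst
  (fun _ _ _ => erefl).
HB.instance Definition _ := GRing.isMonoidMorphism.Build prod_cdga A prod_fst
  (conj erefl (fun _ _ => erefl)).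
Lemma prod_fst_homog n x : x \in homog prod_cdga n -> prod_fst x \in homog A n.
Proof. by rewrite /homog prod_homog => /andP[]. Qed.
Definition prod_fst_hom : cdga_hom prod_cdga A :=
  @CDGAHom _ prod_cdga A (GCAHom prod_fst_homog) (fun=> erefl).

Definition prod_snd : prod_cdga -> B := snd.
HB.instance Definition _ := GRing.isLinear.Build K prod_cdga B _ prod_snd
  (fun _ _ _ => erefl).
HB.instance Definition _ := GRing.isMonoidMorphism.Build prod_cdga B prod_snd
  (conj erefl (fun _ _ => erefl)).
Lemma prod_snd_homog n x : x \in homog prod_cdga n -> prod_snd x \in homog B n.
Proof. by rewrite /homog prod_homog => /andP[]. Qed.
Definition prod_snd_hom : cdga_hom prod_cdga B :=
  @CDGAHom _ prod_cdga B (GCAHom prod_snd_homog) (fun=> erefl).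
End Product.

(** * Morphisms *)

Section Morphisms.
Variable K : fieldType.

Definition gca_id_fun (A : gca K) : A -> A := idfun.
HB.instance Definition _ (A : gca K) := GRing.isLinear.Build K A A _ (@gca_id_fun A)
  (fun _ _ _ => erefl).
HB.instance Definition _ (A : gca K) := GRing.isMonoidMorphism.Build A A (@gca_id_fun A)
  (conj erefl (fun _ _ => erefl)).
Definition gca_id (A : gca K) : gca_hom A A :=
  @GCAHom _ A A (@gca_id_fun A) (fun _ _ => id).
Definition cdga_id (A : cdga K) : cdga_hom A A :=
  @CDGAHom _ A A (gca_id A) (fun=> erefl).

Section Comp.
Variables A B C : gca K.
Definition gca_comp_fun (g : gca_hom B C) (f : gca_hom A B) : A -> C := g \o f.
Lemma gca_comp_linear g f : linear (gca_comp_fun g f).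
Proof. by move=> a x y; rewrite /gca_comp_fun /= !linearP. Qed.
Lemma gca_comp_monoid g f : monoid_morphism (gca_comp_fun g f).
Proof. by split=> [|x y]; rewrite /gca_comp_fun /= ?rmorph1 ?rmorphM. Qed.
HB.instance Definition _ g f :=
  GRing.isLinear.Build K A C _ (gca_comp_fun g f) (gca_comp_linear g f).
HB.instance Definition _ g f :=
  GRing.isMonoidMorphism.Build A C (gca_comp_fun g f) (gca_comp_monoid g f).
Definition gca_comp (g : gca_hom B C) (f : gca_hom A B) : gca_hom A C :=
  @GCAHom _ A C (gca_comp_fun g f)
    (fun n x hx => gca_fun_homog g (gca_fun_homog f hx)).
End Comp.

Lemma cdga_comp_dif (A B C : cdga K) (g : cdga_hom B C) (f : cdga_hom A B) x :
  gca_comp g f (dif A x) = dif C (gca_comp g f x).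
Proof. by rewrite /= /gca_comp_fun /= !cdga_fun_dif. Qed.
Definition cdga_comp (A B C : cdga K) (g : cdga_hom B C) (f : cdga_hom A B) :
  cdga_hom A C := CDGAHom (cdga_comp_dif g f).

(** By freeness V -> S extends to a morphism /\V -> S; its composite with the inclusion
    S -> /\V extends V -> /\V, so that it is the identity. *)
Lemma free_gca_ind (I : Type) (deg : I -> nat) (V : I -> lmodType K) (L : gca K)
    (u : forall i, {linear V i -> L}) (S : graded_subalg L) :
  is_free_gca deg u -> (forall i v, u i v \in gsub_pred S) ->
  forall x, x \in gsub_pred S.
Proof.
move=> [uh uU] uS x.
pose w i (v : V i) : gsub_gca S := exist (fun y => y \in gsub_pred S) _ (uS i v).
have wl i : linear (w i) by move=> a y z; apply: val_inj; rewrite /= linearP.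
pose wL i := HB.pack_for {linear V i -> gsub_gca S} (w i)
  (GRing.isLinear.Build K (V i) (gsub_gca S) _ (w i) (wl i)).
have wh i v : wL i v \in homog (gsub_gca S) (deg i).
  by rewrite /homog gsub_homog; exact: uh.
have [h [hu _]] := uU _ wL wh.
have [k [_ kU]] := uU _ u uh.
have -> : x = val (h x).
  rewrite -[LHS]/(gca_id L x) (kU (gca_id L)) //.
  rewrite -[RHS]/(gca_comp (gsub_incl S) h x); symmetry; apply: kU => i v.
  by rewrite /= /gca_comp_fun /= hu.
exact: valP.
Qed.
End Morphisms.

Lemma cdga_inverse (K : numFieldType) (A B : cdga K) (f : cdga_hom A B) : bijective f ->
  exists g : cdga_hom B A, cancel g f.
Proof.
case=> g fK gK.
have fI := can_inj fK.
have gl : linear g by move=> a x y; apply: fI; rewrite linearP /= !gK.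
have gm : monoid_morphism g.
  by split=> [|x y]; apply: fI; rewrite gK ?rmorph1 // rmorphM /= !gK.
pose gL := HB.pack_for {lrmorphism B -> A} g
  (GRing.isLinear.Build K B A _ g gl) (GRing.isMonoidMorphism.Build B A g gm).
have gh n x : x \in homog B n -> gL x \in homog A n.
  move=> /homogP hx; apply/homogP/fI.
  by rewrite -hom_hcomp /= gK.
have gd x : gL (dif B x) = dif A (gL x).
  by apply: fI; rewrite cdga_fun_dif /= !gK.
by exists (CDGAHom (cdga_fun := GCAHom gh) gd); exact: gK.
Qed.

(** * Linear relations and finite spans *)

(** A maximal linear, single-valued part G of R is defined everywhere: outside its
    domain it could be extended by one pair (u, b) of R. This replaces the choice of a
    basis of U. *)
Lemma linear_selection (K : fieldType) (U W : lmodType K) (R : U -> W -> Prop) :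
  (forall c x y a b, R x a -> R y b -> R (c *: x + y) (c *: a + b)) ->
  (forall x, exists a, R x a) -> exists w : {linear U -> W}, forall x, R x (w x).
Proof.
move=> Rlin Rtot.
have R0 : R 0 0.
  by have [a Ra] := Rtot 0; have := Rlin (-1) _ _ _ _ Ra Ra; rewrite !scaleN1r !addNr.
pose part (G : U -> W -> Prop) := [/\ G 0 0,
  forall c x y a b, G x a -> G y b -> G (c *: x + y) (c *: a + b),
  forall a, G 0 a -> a = 0 & forall x a, G x a -> R x a].
pose le (G H : {G | part G}) := `[< forall x a, sval G x a -> sval H x a >].
have part0 : part (fun x a => x = 0 /\ a = 0).
  split=> // [c x y a b [-> ->] [-> ->]|a []//|x a [-> ->] //].
  by rewrite !scaler0 !addr0.
have [||A Atot|[G partG] Gmax] :=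
    @ZL_preorder {G | part G} (exist part _ part0) le.
- by move=> G; apply/asboolP.
- by move=> G H I /asboolP GH /asboolP HI; apply/asboolP => x a /GH /HI.
- have [[G AG]|A0] := pselect (exists G, A G); last first.
    by exists (exist part _ part0) => G AG; case: A0; exists G.
  have partU : part (fun x a => exists2 H, A H & sval H x a).
    split.
    + by exists G => //; case: (svalP G).
    + move=> c x y a b [H AH Hx] [I AI Iy].
      have [/asboolP HI|/asboolP IH] := Atot _ _ AH AI.
        by exists I => //; case: (svalP I) => _ + _ _; apply => //; exact: HI.
      by exists H => //; case: (svalP H) => _ + _ _; apply => //; exact: IH.
    + by move=> a [H AH Ha]; case: (svalP H) => _ _ + _; exact.
    + by move=> x a [H AH Ha]; case: (svalP H) => _ _ _; exact.
  by exists (exist part _ partU) => H AH; apply/asboolP => x a Hx; exists H.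
have [G0 Glin Gfun GR] := partG.
have Gtot u : exists a, G u a.
  apply: contrapT => Gu; have [b Rub] := Rtot u.
  pose H x a := exists y c d, [/\ G y d, x = c *: u + y & a = c *: b + d].
  have partH : part H.
    split.
    + by exists 0, 0, 0; rewrite !scale0r !addr0.
    + move=> c _ _ _ _ [y [e [d [Gy -> ->]]]] [y' [e' [d' [Gy' -> ->]]]].
      exists (c *: y + y'), (c * e + e'), (c *: d + d'); split; first exact: Glin.
        by rewrite scalerDr scalerDl scalerA addrACA.
      by rewrite scalerDr scalerDl scalerA addrACA.
    + move=> _ [y [c [d [Gy + ->]]]]; have [->|c0] := eqVneq c 0.
        by rewrite !scale0r !add0r => y0; apply: Gfun; rewrite y0.
      move=> uy; case: Gu; exists (- c^-1 *: d + 0).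
      have -> : u = - c^-1 *: y + 0.
        rewrite addr0 -(addKr (c *: u) y) -uy addr0 scaleNr scalerN opprK scalerA.
        by rewrite mulVf ?scale1r.
      exact: Glin.
    + by move=> _ _ [y [c [d [Gy -> ->]]]]; apply: Rlin => //; exact: GR.
  have /Gmax/asboolP HG : le (exist part G partG) (exist part H partH).
    by apply/asboolP => x a Gx; exists x, 0, a; rewrite !scale0r !add0r.
  case: Gu; exists b; apply: (HG u b).
  by exists 0, 1, 0; rewrite !scale1r !addr0.
have [w Gw] := choice Gtot.
have wlin : linear w.
  move=> c x y; apply: subr0_eq; rewrite [_ - _]addrC -scaleN1r; apply: Gfun.
  have := Glin (-1) _ _ _ _ (Glin c _ _ _ _ (Gw x) (Gw y)) (Gw (c *: x + y)).
  by have -> : -1 *: (c *: x + y) + (c *: x + y) = 0 by rewrite scaleN1r addNr.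
exists (HB.pack_for {linear U -> W} w (GRing.isLinear.Build K U W _ w wlin)) => x.
exact/GR/Gw.
Qed.

(** The coefficients are indexed by all of nat so that the induction on e in
    [in_span_cons] needs no change of index type. *)
Definition in_span (K : fieldType) (V : lmodType K) (e : seq V) (x : V) : Prop :=
  exists c : nat -> K, x = \sum_(i < size e) c i *: e`_i.

Section Span.
Variables (K : fieldType) (V : lmodType K).
Implicit Types (e : seq V) (x y : V).

Lemma in_span_cons a e x :
  in_span (a :: e) x <-> exists c y, in_span e y /\ x = c *: a + y.
Proof.
split=> [[c ->]|[c [_ [[d ->] ->]]]].
  exists (c 0), (\sum_(i < size e) c i.+1 *: e`_i).
  by split; [exists (c \o S) | rewrite big_ord_recl].
by exists (fun i => if i is j.+1 then d j else c); rewrite big_ord_recl.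
Qed.

Lemma in_span0 e : in_span e 0.
Proof. by exists (fun=> 0); rewrite big1 // => i _; rewrite scale0r. Qed.

Lemma in_spanP e c x y : in_span e x -> in_span e y -> in_span e (c *: x + y).
Proof.
move=> [a ->] [b ->]; exists (fun i => c * a i + b i).
rewrite scaler_sumr -big_split; apply: eq_bigr => i _.
by rewrite scalerDl scalerA.
Qed.

Lemma in_spanD e x y : in_span e x -> in_span e y -> in_span e (x + y).
Proof. by rewrite -{2}(scale1r x); exact: in_spanP. Qed.

Lemma in_spanZ e c x : in_span e x -> in_span e (c *: x).
Proof. by move=> ex; rewrite -[_ *: x]addr0; apply: in_spanP (in_span0 e). Qed.

Lemma in_span_sum e (I : Type) (r : seq I) (F : I -> V) :
  (forall i, in_span e (F i)) -> in_span e (\sum_(i <- r) F i).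
Proof.
move=> eF; apply: big_ind => [|x y|i _]; [exact: in_span0|exact: in_spanD|exact: eF].
Qed.

Lemma mem_in_span e x : x \in e -> in_span e x.
Proof.
elim: e => // a e IHe; rewrite inE => /orP[/eqP <-|/IHe ex]; apply/in_span_cons.
  by exists 1, 0; split; [exact: in_span0 | rewrite scale1r addr0].
by exists 0, x; rewrite scale0r add0r.
Qed.

Lemma finite_dim_span e : (forall x, in_span e x) -> finite_dim V.
Proof.
move=> He; exists (size e), (fun i => e`_i) => x.
by have [c ->] := He x; exists (fun i => c i).
Qed.

Lemma span_finite_dim : finite_dim V -> exists e, forall x, in_span e x.
Proof.
move=> [n [e He]]; exists [seq e i | i <- enum 'I_n] => x.
have [c ->] := He x; apply: in_span_sum => i; apply: in_spanZ.
by apply: mem_in_span; apply: map_f; rewrite mem_enum.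
Qed.
End Span.

(** The domain is cut down to a subspace P because the induction removes the first
    spanning vector a by passing to the subspace of those x for which F x can be written
    without a; at most one further generator x0 is needed for the rest. *)
Lemma finite_rank_span (K : fieldType) (V W : lmodType K) (F : {linear V -> W})
    (e : seq W) (P : V -> Prop) :
  (forall c x y, P x -> P y -> P (c *: x + y)) ->
  (forall x, P x -> in_span e (F x)) ->
  exists v : seq V, forall x, P x -> exists2 y, in_span v y & F x = F y.
Proof.
elim: e P => [|a e IHe] P Plin PF.
  exists [::] => x /PF [c]; rewrite big_ord0 => Fx.
  by exists 0; [exact: in_span0 | rewrite raddf0].
pose Q x := P x /\ in_span e (F x).
have Qlin c x y : Q x -> Q y -> Q (c *: x + y).
  move=> [Px ex] [Py ey]; split; first exact: Plin.
  by rewrite linearP; exact: in_spanP.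
have [v hv] := IHe Q Qlin (fun x => @proj2 _ _).
have [[x0 [c0 [y0 [Px0 c0_neq0 ey0 Fx0]]]]|no] := pselect (exists x0 c0 y0,
    [/\ P x0, c0 != 0, in_span e y0 & F x0 = c0 *: a + y0]); last first.
  exists v => x Px; apply: hv; split => //.
  have /in_span_cons[c [y [ey Fx]]] := PF _ Px.
  have [c0|c0] := eqVneq c 0; first by rewrite Fx c0 scale0r add0r.
  by case: no; exists x, c, y.
exists (x0 :: v) => x Px.
have /in_span_cons[c [y [ey Fx]]] := PF _ Px.
have [|z vz Fz] := hv (- (c / c0) *: x0 + x).
  split; first exact: Plin.
  rewrite linearP /= Fx0 Fx scalerDr scalerA addrACA -scalerDl mulNr divfK // addNr scale0r.
  by rewrite add0r; exact: in_spanP.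
exists ((c / c0) *: x0 + z); first by apply/in_span_cons; exists (c / c0), z.
by rewrite linearP /= -Fz linearP /= scaleNr addNKr.
Qed.

(** * q-equivalences in terms of cocycles *)

Section QEquivalence.
Variable K : fieldType.
Implicit Types A B C : cdga K.

Lemma cocycleP A n (a : A) :
  reflect (a \in homog A n /\ dif A a = 0) (a \in cocycle A n).
Proof. by apply: (iffP andP) => -[ha /eqP da]; split=> //; apply/eqP. Qed.

Lemma cohclass_eq A n (z w : Zspace A n) :
  cohclass z = cohclass w <-> exists b, val z - val w = dif A b.
Proof. by rewrite cohclassE; split=> [/asboolP|?]; [|apply/asboolP]. Qed.

Definition coh_inj n A B (f : cdga_hom A B) : Prop :=
  forall a, a \in cocycle A n -> (exists c, f a = dif B c) -> exists b, a = dif A b.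

Definition coh_surj n A B (f : cdga_hom A B) : Prop :=
  forall c, c \in cocycle B n ->
    exists2 a, a \in cocycle A n & exists b, c = f a + dif B b.

Lemma coh_injP n A B (f : cdga_hom A B) :
  injective (coh_map f (n := n)) <-> coh_inj n f.
Proof.
split=> [fI a az [c fac]|fI].
  pose z : Zspace A n := exist (fun x => x \in cocycle A n) a az.
  have : coh_map f (cohclass z) = coh_map f (cohclass 0).
    by rewrite !coh_mapE; apply/cohclass_eq; exists c; rewrite /= raddf0 subr0.
  by move=> /fI/cohclass_eq[b]; rewrite subr0 => ab; exists b.
apply: coh_ind => z; apply: coh_ind => w; rewrite !coh_mapE => /cohclass_eq[c].
rewrite /= -raddfB => fzw; apply/cohclass_eq.
by apply: fI (ex_intro _ c fzw); exact: (rpredB (valP z) (valP w)).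
Qed.

Lemma coh_surjP n A B (f : cdga_hom A B) :
  (forall v, exists u, coh_map f (n := n) u = v) <-> coh_surj n f.
Proof.
split=> [fS c cz|fS].
  pose z : Zspace B n := exist (fun x => x \in cocycle B n) c cz.
  have [u] := fS (cohclass z); move: u; apply: coh_ind => w.
  rewrite coh_mapE => /esym/cohclass_eq[b /= cb].
  by exists (val w); [exact: valP | exists b; rewrite -cb addrC subrK].
apply: coh_ind => z; have [a az [b zb]] := fS _ (valP z).
exists (cohclass (exist (fun x => x \in cocycle A n) a az)).
by rewrite coh_mapE; apply/esym/cohclass_eq; exists b; rewrite /= zb addrC addKr.
Qed.

Lemma q_equivalenceP q A B (f : cdga_hom A B) : q_equivalence q f <->
  (forall i, (i <= q)%N -> coh_surj i f) /\ (forall i, (i <= q.+1)%N -> coh_inj i f).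
Proof.
split=> [[fB fI]|[fS fI]].
  split=> i iq; first by apply/coh_surjP => v; have [g _ gK] := fB i iq; exists (g v).
  apply/coh_injP; move: iq; rewrite leq_eqVlt => /orP[/eqP ->//|iq].
  exact: bij_inj (fB i iq).
split=> [i iq|]; last exact/coh_injP/fI.
have /coh_injP fi := fI i (leqW iq).
have /coh_surjP/choice[g gK] := fS i iq.
by exists g => // u; apply: fi.
Qed.

Lemma q_equivalence_comp q A B C (f : cdga_hom A B) (g : cdga_hom B C) :
  q_equivalence q f -> q_equivalence q g -> q_equivalence q (cdga_comp g f).
Proof.
move=> /q_equivalenceP[fS fI] /q_equivalenceP[gS gI]; apply/q_equivalenceP.
split=> i iq.
  move=> c /(gS i iq)[b /(fS i iq)[a az [e ->]] [e' ->]].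
  exists a => //; exists (g e + e').
  by rewrite !raddfD /= cdga_fun_dif addrA.
move=> a az [c gfa]; apply: (fI i iq) => //; apply: (gI i iq); last by exists c.
exact: cocycle_map.
Qed.

Lemma q_equivalence_cancel q A B C (f : cdga_hom A B) (g : cdga_hom B C)
    (h : cdga_hom A C) : (forall x, g (f x) = h x) ->
  q_equivalence q g -> q_equivalence q h -> q_equivalence q f.
Proof.
move=> gf /q_equivalenceP[gS gI] /q_equivalenceP[hS hI]; apply/q_equivalenceP.
split=> i iq.
  move=> b bz; have [a az [c gb]] := hS i iq _ (cocycle_map g bz).
  exists a => //; have [||e be] := gI i (leqW iq) (b - f a).
  - by apply: rpredB bz _; exact: cocycle_map.
  - by exists c; rewrite raddfB /= gb gf addrC addKr.
  by exists e; rewrite -be addrC subrK.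
move=> a az [c fa]; apply: (hI i iq) => //; exists (g c).
by rewrite -gf fa cdga_fun_dif.
Qed.

Lemma q_equivalence_cohomologous q A B (f g : cdga_hom A B) :
  (forall n a, a \in cocycle A n -> exists e, f a = g a + dif B e) ->
  q_equivalence q f -> q_equivalence q g.
Proof.
move=> fg /q_equivalenceP[fS fI]; apply/q_equivalenceP; split=> i iq.
  move=> c /(fS i iq)[a az [e ->]]; exists a => //.
  by have [e' ->] := fg _ _ az; exists (e' + e); rewrite raddfD addrA.
move=> a az [c ga]; apply: (fI i iq) => //.
by have [e ->] := fg _ _ az; exists (c + e); rewrite ga raddfD.
Qed.
End QEquivalence.

Lemma difB (K : fieldType) (A : cdga K) (x y : A) : dif A (x - y) = dif A x - dif A y.
Proof. exact: raddfB. Qed.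

Lemma homB (K : fieldType) (A B : cdga K) (f : cdga_hom A B) x y : f (x - y) = f x - f y.
Proof. exact: raddfB. Qed.

Lemma homD (K : fieldType) (A B : cdga K) (f : cdga_hom A B) x y : f (x + y) = f x + f y.
Proof. exact: raddfD. Qed.

Lemma difD (K : fieldType) (A : cdga K) (x y : A) : dif A (x + y) = dif A x + dif A y.
Proof. exact: raddfD. Qed.

(** * The path fibration of a morphism *)

(** The cdga C[t,dt] is a path object for C; its endpoints are the evaluations at t = 0
    and t = 1. *)
Section PathObject.
Variables (K : numFieldType) (C : cdga K).
Implicit Types (x y : pext C) (c : C).

Definition path_start : cdga_hom (pext C) C := pext_hom (cdga_id C) (rpred0 (homog C 0)).
Definition path_end : cdga_hom (pext C) C := pext_hom (cdga_id C) (gca_one C).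

Lemma map_poly_cdga_id (p : {poly C}) : map_poly (cdga_id C) p = p.
Proof. by apply/polyP => i; rewrite coef_map. Qed.

Lemma path_startE x : path_start x = x.1`_0.
Proof. by rewrite /= /pext_eval !map_poly_cdga_id raddf0 mulr0 addr0 horner_coef0. Qed.

Lemma path_endE x : path_end x = x.1.[1].
Proof. by rewrite /= /pext_eval !map_poly_cdga_id dif1 mulr0 addr0. Qed.

Definition path_const c : pext C := (c%:P, 0).

Lemma path_const0 : path_const 0 = 0.
Proof. by rewrite /path_const polyC0. Qed.

Lemma path_const_homog n c : c \in homog C n -> path_const c \in homog (pext C) n.
Proof.
move=> hc; apply/pext_homogP; split=> i; last by rewrite coef0; case: n hc => // n; rewrite rpred0.
by rewrite coefC; case: eqP => // _; exact: rpred0.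
Qed.

Lemma path_const_dif c : dif (pext C) (path_const c) = path_const (dif C c).
Proof.
by rewrite /= /pext_dif /= !map_polyC /= derivC raddf0 addr0.
Qed.

(** The path t * c joins 0 to c. *)
Lemma path_end_surj c : exists2 x, path_start x = 0 & path_end x = c.
Proof.
exists (c%:P * 'X, 0); first by rewrite path_startE /= coefMX.
by rewrite path_endE /= hornerMX hornerC mulr1.
Qed.

(** Write x = p + q dt. The primitive is the integral of q dt from 0, in which par
    accounts for the sign in d(a t^k) = da t^k + (-1)^|a| k a t^(k-1) dt. That it also
    accounts for p is the equation dx = 0, together with p(0) = 0. *)
Lemma poincare x : dif (pext C) x = 0 -> path_start x = 0 ->
  exists2 y, x = dif (pext C) y & path_start y = 0.
Proof.
rewrite path_startE => dx x0.
(* The coefficient of t^k dt in dx. *)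
have dx2 k : par (x.1`_k.+1) *+ k.+1 + dif C x.2`_k = 0.
  have := congr1 (fun y : pext C => y.2`_k) dx.
  by rewrite /= coefD coef_deriv !coef_map coef0.
pose a k := (k.+1%:R^-1 : K) *: par (x.2`_k).
pose y : pext C := (\poly_(k < (size x.2).+1) (if k is l.+1 then a l else 0), 0).
have yE k : y.1`_k = if k is l.+1 then a l else 0.
  rewrite coef_poly; case: ltnP => //; case: k => // k; rewrite ltnS => xk.
  by rewrite /a nth_default // raddf0 scaler0.
exists y; last by rewrite path_startE yE.
apply: pextP => k; rewrite /= ?coefD ?coef_deriv !coef_map ?coef0 ?raddf0 ?addr0 /= yE.
  case: k => [|k]; first by rewrite raddf0.
  rewrite /a linearZ /= dif_par.
  have -> : dif C x.2`_k = - (par (x.1`_k.+1) *+ k.+1).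
    by apply/eqP; rewrite -addr_eq0 addrC dx2.
  rewrite [par (- _)]raddfN /= opprK [par (_ *+ _)]raddfMn /= [par _]parityK.
  by rewrite -scaler_nat scalerA mulVf ?scale1r // pnatr_eq0.
rewrite /a linearZ /= [par _]parityK.
by rewrite -scaler_nat scalerA mulfV ?scale1r // pnatr_eq0.
Qed.

End PathObject.

Section PathFibration.
Variables (K : numFieldType) (B C : cdga K) (phi : cdga_hom B C).

(** The fibration is the pullback of phi along the start map of the path object. *)
Definition fib_pred : {pred prod_cdga B (pext C)} :=
  [pred x | phi x.1 == path_start C x.2].
Lemma fib_alg : subalg_closed fib_pred.
Proof.
split=> [|a x y /eqP hx /eqP hy|x y /eqP hx /eqP hy]; apply/eqP.
- by rewrite [LHS]rmorph1 [RHS]rmorph1.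
- by rewrite [LHS]linearP [RHS]linearP /= hx hy.
by rewrite [LHS]rmorphM [RHS]rmorphM /= hx hy.
Qed.
Lemma fib_hcomp n x : x \in fib_pred ->
  hcomp (gca_grading (prod_cdga B (pext C))) n x \in fib_pred.
Proof. by move=> /eqP hx; apply/eqP; rewrite -!hom_hcomp hx. Qed.
Lemma fib_dif x : x \in fib_pred -> dif (prod_cdga B (pext C)) x \in fib_pred.
Proof. by move=> /eqP hx; apply/eqP; rewrite !cdga_fun_dif hx. Qed.

Definition fib_sub : graded_subalg (prod_cdga B (pext C)) := GradedSubalg fib_alg fib_hcomp.
Definition fib : cdga K := @csub K (prod_cdga B (pext C)) fib_sub fib_dif.
Definition fib_incl : cdga_hom fib (prod_cdga B (pext C)) :=
  @csub_incl K (prod_cdga B (pext C)) fib_sub fib_dif.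
Definition fib_base : cdga_hom fib B :=
  cdga_comp (prod_fst_hom B (pext C)) fib_incl.
Definition fib_path : cdga_hom fib (pext C) :=
  cdga_comp (prod_snd_hom B (pext C)) fib_incl.
Definition fib_end : cdga_hom fib C := cdga_comp (path_end C) fib_path.

Lemma fib_eq (v w : fib) : fib_base v = fib_base w -> fib_path v = fib_path w -> v = w.
Proof.
case: v w => [[b x] v] [[b' x'] w] /= vw1 vw2.
by apply: val_inj; congr (_, _).
Qed.

Lemma fib_intro b x : phi b = path_start C x ->
  exists2 v : fib, fib_base v = b & fib_path v = x.
Proof.
move=> bx; have vP : (b, x) \in fib_pred by apply/eqP.
by exists (exist (fun y => y \in fib_pred) (b, x) vP).
Qed.

Lemma fibP (v : fib) : phi (fib_base v) = path_start C (fib_path v).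
Proof. by have /eqP := valP v. Qed.

Lemma fib_homog n (v : fib) : fib_base v \in homog B n ->
  fib_path v \in homog (pext C) n -> v \in homog fib n.
Proof.
move=> h1 h2; rewrite /homog (@gsub_homog K (prod_cdga B (pext C))).
by apply/andP.
Qed.

Lemma fib_end_surj c : exists v, fib_end v = c.
Proof.
have [x x0 x1] := path_end_surj c.
have [|v _ vx] := @fib_intro 0 x; first by rewrite x0 raddf0.
by exists v; rewrite -x1 -vx.
Qed.

(** The constant path at phi b provides a section of the projection, and its kernel, the
    paths that start at 0, is acyclic by the Poincare lemma. *)
Lemma fib_base_q_equivalence q : q_equivalence q fib_base.
Proof.
have const b : exists2 v : fib, fib_base v = b & fib_path v = path_const (phi b).
  by apply: fib_intro; rewrite path_startE coefC.
apply/q_equivalenceP; split=> i _.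
  move=> b /cocycleP[hb db]; have [v v1 v2] := const b.
  exists v; last by exists 0; rewrite raddf0 addr0.
  apply/cocycleP; split.
    by apply: fib_homog; rewrite ?v1 ?v2 //; apply/path_const_homog/gca_fun_homog.
  apply: fib_eq; rewrite cdga_fun_dif [RHS]raddf0 ?v1 ?v2 //.
  by rewrite path_const_dif -cdga_fun_dif db raddf0.
move=> v /cocycleP[_ dv] [e ve]; have [w w1 w2] := const e.
have [||y xy y0] := @poincare _ C (fib_path v - path_const (dif C (phi e))).
- rewrite difB -(cdga_fun_dif fib_path) dv raddf0.
  by rewrite path_const_dif dif_dif path_const0 subr0.
- by rewrite homB -fibP ve path_startE coefC /= cdga_fun_dif subrr.
have [|u u1 u2] := @fib_intro 0 y; first by rewrite y0 raddf0.
exists (w + u); apply: fib_eq.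
  by rewrite (cdga_fun_dif fib_base) homD u1 w1 addr0.
rewrite (cdga_fun_dif fib_path) homD u2 w2 difD -xy path_const_dif.
by rewrite addrC subrK.
Qed.

(** By the Poincare lemma a closed path x differs from the constant path at its start by
    the differential of a path y; hence the start and the end of x are cohomologous.
    On cohomology the end map is thus the composite of the projection with phi. *)
Lemma fib_end_q_equivalence q : q_equivalence q phi -> q_equivalence q fib_end.
Proof.
move=> phi_qe.
have := q_equivalence_comp (fib_base_q_equivalence q) phi_qe.
apply: q_equivalence_cohomologous => n v /cocycleP[_ dv].
set x := fib_path v.
have [||y xy y0] := @poincare _ C (x - path_const (phi (fib_base v))).
- rewrite difB path_const_dif -(cdga_fun_dif fib_path) -(cdga_fun_dif phi).
  rewrite -(cdga_fun_dif fib_base) dv (raddf0 fib_path) (raddf0 fib_base) (raddf0 phi).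
  by rewrite path_const0 subr0.
- by rewrite homB -fibP path_startE coefC subrr.
have yE : dif C (path_end C y) = path_end C x - phi (fib_base v).
  by rewrite -cdga_fun_dif -xy homB [X in _ - X]path_endE hornerC.
exists (- path_end C y); have -> : dif C (- path_end C y) = - dif C (path_end C y).
  exact: raddfN.
by rewrite yE opprB addrC subrK.
Qed.
End PathFibration.

(** * The universal property of a Hirsch extension *)

Section LinearExtensionality.
Variable K : fieldType.

Lemma homog_lin_eq (V W : lmodType K) (gr : grading V) (f h : V -> W) :
  linear f -> linear h -> (forall n x, x \in homog_of gr n -> f x = h x) -> f =1 h.
Proof.
move=> fl hl.
exact: (@homog_eq _ _ gr _
  (HB.pack_for {linear V -> W} f (GRing.isLinear.Build K V W _ f fl))
  (HB.pack_for {linear V -> W} h (GRing.isLinear.Build K V W _ h hl))).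
Qed.

Lemma tensor_eq (U V T W : lmodType K) (t : U -> V -> T) (f h : T -> W) :
  is_tensor t -> linear f -> linear h ->
  (forall u v, f (t u v) = h (t u v)) -> f =1 h.
Proof.
move=> [[tr tl] tU] fl hl fh.
pose fL := HB.pack_for {linear T -> W} f (GRing.isLinear.Build K T W _ f fl).
pose hL := HB.pack_for {linear T -> W} h (GRing.isLinear.Build K T W _ h hl).
have [|k [_ kU]] := tU W (fun u v => f (t u v)).
  split=> [u a x y|v a x y]; first by rewrite tr; exact: fl.
  by rewrite [t (_ *: _ + _) v]tl; exact: fl.
by move=> x; rewrite [LHS](kU fL) // [RHS](kU hL).
Qed.
End LinearExtensionality.

Lemma gca_hom_par (K : fieldType) (A B : cdga K) (f : gca_hom A B) x :
  f (par x) = par (f x).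
Proof.
move: x; apply: (@homog_eq _ _ (gca_grading A) _ (f \o @par _ A) (@par _ B \o f)) => n x hx /=.
by rewrite (par_homog hx) (par_homog (gca_fun_homog f hx)) linearZ.
Qed.

Section HirschUniversal.
Variables (K : numFieldType) (i : nat) (B B' : cdga K) (iota : cdga_hom B B').
Variables (U : lmodType K) (L : gca K) (u : {linear U -> L}) (lam : gca_hom L B').
Hypothesis L_free : is_free_gca (fun _ : unit => i) (V := fun=> U) (fun=> u).
Hypothesis B'_tensor : is_tensor (fun (b : B) (l : L) => iota b * lam l).

Lemma hirsch_eq (P : cdga K) (f h : cdga_hom B' P) :
  (forall b, f (iota b) = h (iota b)) ->
  (forall x, f (lam (u x)) = h (lam (u x))) -> f =1 h.
Proof.
move=> fhB fhU; apply: (tensor_eq B'_tensor); [exact: linearP|exact: linearP|].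
move=> b l; rewrite !rmorphM /= fhB; congr (_ * _).
have uh (_ : unit) x : (f \o lam \o u) x \in homog P i.
  by do 2!apply: gca_fun_homog; exact: (L_free.1 tt).
have [k [_ kU]] := L_free.2 P (fun=> f \o lam \o u) uh.
rewrite -[LHS]/(gca_comp f lam l) -[RHS]/(gca_comp h lam l).
rewrite (kU (gca_comp f lam)) // (kU (gca_comp h lam)) // => _ x.
exact: esym (fhU x).
Qed.

(** The linear map b (x) l |-> g b * h l on B' = B (x) L is a morphism of graded algebras,
    because the factors commute up to the same sign in B' and in P. *)
Section Extend.
Variables (P : cdga K) (g : cdga_hom B P) (h : gca_hom L P).

Variable T : {linear B' -> P}.
Hypothesis TE : forall b l, T (iota b * lam l) = g b * h l.

Lemma extend_iota b : T (iota b) = g b.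
Proof. by have := TE b 1; rewrite !rmorph1 !mulr1. Qed.

Lemma extend_lam l : T (lam l) = h l.
Proof. by have := TE 1 l; rewrite !rmorph1 !mul1r. Qed.

Lemma extend_mul x y : T (x * y) = T x * T y.
Proof.
move: x; apply: (tensor_eq B'_tensor) => [a x x'|a x x'|b l].
- by rewrite mulrDl -scalerAl linearP.
- by rewrite linearP mulrDl -scalerAl.
move: y; apply: (tensor_eq B'_tensor) => [a x x'|a x x'|b' l'].
- by rewrite mulrDr -scalerAr linearP.
- by rewrite linearP mulrDr -scalerAr.
move: l; apply: (homog_lin_eq (gr := gca_grading L)) => [a x x'|a x x'|m l hl].
- by rewrite linearP mulrDr mulrDl -scalerAr -scalerAl linearP.
- by rewrite linearP mulrDr -scalerAr linearP mulrDl -scalerAl.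
move: b'; apply: (homog_lin_eq (gr := gca_grading B)) => [a x x'|a x x'|n b' hb'].
- by rewrite linearP mulrDl mulrDr -scalerAl -scalerAr linearP.
- by rewrite linearP mulrDl -scalerAl linearP mulrDr -scalerAr.
have comm (Q : cdga K) (x y z w : Q) : y \in homog Q m -> z \in homog Q n ->
    x * y * (z * w) = (-1) ^+ (m * n) *: (x * z * (y * w)).
  move=> hy hz; rewrite -mulrA (mulrA y) (gca_comm hy hz) sgnZ.
  by rewrite -scalerAl -scalerAr !mulrA.
rewrite (TE b l) (TE b' l').
rewrite (comm _ _ _ _ _ (gca_fun_homog lam hl) (gca_fun_homog iota hb')).
rewrite (comm _ _ _ _ _ (gca_fun_homog h hl) (gca_fun_homog g hb')).
rewrite -(rmorphM iota) -(rmorphM lam) linearZ /= (TE (b * b') (l * l')).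
by rewrite (rmorphM g) (rmorphM h).
Qed.

Lemma extend_hcomp n x :
  T (hcomp (gca_grading B') n x) = hcomp (gca_grading P) n (T x).
Proof.
move: x; apply: (tensor_eq B'_tensor) => [a x y|a x y|b l]; rewrite ?linearP //=.
move: b; apply: (homog_lin_eq (gr := gca_grading B)) => [a x y|a x y|j b hb].
- by rewrite linearP mulrDl -scalerAl !linearP.
- by rewrite linearP mulrDl -scalerAl !linearP.
move: l; apply: (homog_lin_eq (gr := gca_grading L)) => [a x y|a x y|k l hl].
- by rewrite linearP mulrDr -scalerAr !linearP.
- by rewrite linearP mulrDr -scalerAr !linearP.
have hB' : iota b * lam l \in homog B' (j + k) by apply: gca_mul; exact: gca_fun_homog.
have hP : g b * h l \in homog P (j + k) by apply: gca_mul; exact: gca_fun_homog.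
by rewrite (TE b l) (hcomp_homog _ hB') (hcomp_homog _ hP); case: eqP; rewrite ?(TE b l) ?raddf0.
Qed.

Lemma extend_homog n x : x \in homog B' n -> T x \in homog P n.
Proof. by move=> /homogP hx; apply/homogP; rewrite -extend_hcomp hx. Qed.

Lemma extend_monoid : monoid_morphism T.
Proof.
split; last exact: extend_mul.
by have := extend_iota 1; rewrite !rmorph1.
Qed.

Definition extend_gca : gca_hom B' P :=
  GCAHom (gca_fun := HB.pack_for {lrmorphism B' -> P} (T : B' -> P)
    (GRing.Linear.on T) (GRing.isMonoidMorphism.Build B' P T extend_monoid)) extend_homog.
End Extend.

(** The morphism of graded algebras determined by g and w commutes with the differentials
    as soon as it does so on the generators u x, because the elements of L on which it
    does form a graded subalgebra. *)
Lemma hirsch_extend (P : cdga K) (g : cdga_hom B P) (w : {linear U -> P}) :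
  (forall x, w x \in homog P i) ->
  (forall x, exists2 z, dif B' (lam (u x)) = iota z & dif P (w x) = g z) ->
  exists f : cdga_hom B' P,
    (forall b, f (iota b) = g b) /\ (forall x, f (lam (u x)) = w x).
Proof.
move=> wh wd; have [h [hu _]] := L_free.2 P (fun=> w) (fun=> wh).
have [|T [TE _]] := B'_tensor.2 P (fun b l => g b * h l).
  split=> [b a x y|l a x y]; first by rewrite linearP mulrDr -scalerAr.
  by rewrite linearP mulrDl -scalerAl.
have [f f_iota f_lam] : exists2 f : gca_hom B' P,
    (forall b, f (iota b) = g b) & (forall l, f (lam l) = h l).
  by exists (extend_gca TE); [exact: (extend_iota TE) | exact: (extend_lam TE)].
have fd_alg : subalg_closed [pred l | f (dif B' (lam l)) == dif P (f (lam l))].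
  split=> [|a x y /eqP hx /eqP hy|x y /eqP hx /eqP hy]; apply/eqP.
  - by rewrite !rmorph1 !dif1 raddf0.
  - by rewrite !linearP /= hx hy.
  by rewrite !rmorphM !dif_mul raddfD /= !rmorphM /= gca_hom_par hx hy.
have fd_hcomp n l : l \in [pred l | f (dif B' (lam l)) == dif P (f (lam l))] ->
    hcomp (gca_grading L) n l \in [pred l | f (dif B' (lam l)) == dif P (f (lam l))].
  by move=> /eqP hl; apply/eqP; rewrite -!hom_hcomp -!hc_dif -hom_hcomp hl.
have fd_lam l : f (dif B' (lam l)) = dif P (f (lam l)).
  apply/eqP; apply: (free_gca_ind (S := GradedSubalg fd_alg fd_hcomp) L_free) => _ x.
  have [z zE wz] := wd x.
  by apply/eqP; rewrite zE f_iota f_lam hu.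
have fd x : f (dif B' x) = dif P (f x).
  move: x; apply: (tensor_eq B'_tensor) => [a x y|a x y|b l]; rewrite ?linearP //=.
  rewrite dif_mul par_f -!cdga_fun_dif [LHS]raddfD /= !rmorphM /= !f_iota.
  by rewrite [RHS]dif_mul -par_f -cdga_fun_dif; congr (_ + _ * _); exact: fd_lam.
exists (CDGAHom (cdga_fun := f) fd); split=> [b|x] /=; first exact: f_iota.
by rewrite f_lam hu.
Qed.
End HirschUniversal.

(** * Lifting q-minimal cdgas *)

(** A q-equivalence p : P -> C which is surjective on cochains has the strict right lifting
    property against q-minimal cdgas. *)
Section Lifting.
Variables (K : numFieldType) (q : nat) (P C : cdga K) (p : cdga_hom P C).
Hypothesis p_surj : forall c, exists v, p v = c.
Hypothesis p_qe : q_equivalence q p.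

(** If p z = dc, then injectivity on H^(i+1) gives b1 with d b1 = z. The error c - p b1 is
    a cocycle, so surjectivity on H^i and on cochains allows it to be corrected without
    changing the differential of b1. *)
Lemma lift_cochain i z c : (i <= q)%N -> z \in cocycle P i.+1 -> c \in homog C i ->
  p z = dif C c -> exists b, [/\ b \in homog P i, p b = c & dif P b = z].
Proof.
move=> iq zP hc pz; have [pS pI] := (q_equivalenceP q p).1 p_qe.
have [b0 zb0] := pI i.+1 iq z zP (ex_intro _ c pz).
have /cocycleP[hz _] := zP.
pose b1 := hcomp (gca_grading P) i b0.
have hb1 : b1 \in homog P i := homog_hcomp _ _ _.
have db1 : dif P b1 = z by rewrite -hc_dif -zb0; exact/homogP.
have [|a /cocycleP[ha da] [e ce]] := pS i iq (c - p b1).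
  apply/cocycleP; split; first by apply: rpredB => //; exact: gca_fun_homog.
  by rewrite difB -cdga_fun_dif db1 pz subrr.
have [e' pe'] := p_surj e.
pose b := b1 + a + dif P e'.
have pb : p b = c by rewrite !homD cdga_fun_dif pe' -addrA -ce addrC subrK.
(* The lift e' of e need not be homogeneous; projecting to degree i repairs this. *)
exists (hcomp (gca_grading P) i b); split; first exact: homog_hcomp.
  by rewrite -hom_hcomp pb; exact/homogP.
rewrite -hc_dif !difD dif_dif da db1 !addr0; exact/homogP.
Qed.

Lemma lift_hirsch i (B B' : cdga K) (iota : cdga_hom B B') (g : cdga_hom B' C)
    (g0 : cdga_hom B P) : (i <= q)%N -> hirsch_extension i iota ->
  (forall b, p (g0 b) = g (iota b)) ->
  exists f : cdga_hom B' P, (forall b, f (iota b) = g0 b) /\ (forall x, p (f x) = g x).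
Proof.
move=> iq [U [L [u [lam [L_free B'_tensor u_dif]]]]] pg0.
have hu x : lam (u x) \in homog B' i by apply: gca_fun_homog; exact: (L_free.1 tt).
pose R x b := [/\ b \in homog P i, p b = g (lam (u x)) &
  exists2 z, dif B' (lam (u x)) = iota z & dif P b = g0 z].
have [c x y a b|x|w wR] := @linear_selection _ _ _ R.
- move=> [ha pa [z za da]] [hb pb [z' zb db]]; split.
  + by apply: rpredD hb; exact: rpredZ.
  + by rewrite !linearP /= pa pb.
  by exists (c *: z + z'); rewrite !linearP /= ?za ?zb ?da ?db.
- have [z zP duz] := u_dif x.
  have [||b [hb pb db]] := @lift_cochain i (g0 z) (g (lam (u x))) iq (cocycle_map g0 zP).
  + exact: gca_fun_homog.
  + by rewrite pg0 -duz cdga_fun_dif.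
  by exists b; split=> //; exists z.
have [|x|f [f_iota f_u]] := hirsch_extend L_free B'_tensor (g := g0) (w := w).
- by move=> x; case: (wR x).
- by case: (wR x).
exists f; split=> //.
apply: (hirsch_eq L_free B'_tensor (f := cdga_comp p f) (h := g)) => [b|x].
  by rewrite /= /gca_comp_fun /= f_iota pg0.
by rewrite /= /gca_comp_fun /= f_u; case: (wR x).
Qed.

(** The lifts on the stages N k must be compatible with the maps s k for the universal
    property of the limit to apply; they are therefore chosen one after the other,
    each as an extension of the preceding one. *)
Lemma lift_limit (N : nat -> cdga K) (s : forall k, cdga_hom (N k) (N k.+1))
    (M : cdga K) (iota : forall k, cdga_hom (N k) M) (g : cdga_hom M C) :
  inductive_limit s iota ->
  (exists f0 : cdga_hom (N 0) P, forall x, p (f0 x) = g (iota 0 x)) ->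
  (forall k (f : cdga_hom (N k) P), (forall x, p (f x) = g (iota k x)) ->
    exists f' : cdga_hom (N k.+1) P,
      (forall x, f' (s k x) = f x) /\ (forall x, p (f' x) = g (iota k.+1 x))) ->
  exists f : cdga_hom M P, forall x, p (f x) = g x.
Proof.
move=> [iotaE limU] /cid[f0 pf0] step.
pose lift k := {f : cdga_hom (N k) P | forall x, p (f x) = g (iota k x)}.
have step' k (f : lift k) : {f' : lift k.+1 | forall x, sval f' (s k x) = sval f x}.
  apply: cid; have [f' [f's pf']] := step k _ (svalP f).
  by exists (exist _ f' pf').
pose F := nat_rect lift (exist _ f0 pf0) (fun k f => sval (step' k f)).
have FE k x : sval (F k.+1) (s k x) = sval (F k) x by exact: svalP (step' k (F k)) x.
have [f [fE _]] := limU P (fun k => sval (F k)) FE.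
have [|h [hE hU]] := limU C (fun k => cdga_comp g (iota k)).
  by move=> k x; rewrite /= /gca_comp_fun /= iotaE.
exists f => x; rewrite -[LHS]/(cdga_comp p f x) (hU (cdga_comp p f)) ?(hU g) //.
by move=> k y; rewrite /= /gca_comp_fun /= fE; exact: (svalP (F k)).
Qed.

Lemma lift_minimal (M : cdga K) (g : cdga_hom M C) : q_minimal q M ->
  exists f : cdga_hom M P, forall x, p (f x) = g x.
Proof.
move=> [_ [N [s [iota [N00 hirsch lim [e /cdga_inverse[e' eK]]]]]]].
suff lift i (iq : (i <= q)%N) (h : cdga_hom (N i 0) C) :
    exists f : cdga_hom (N i 0) P, forall x, p (f x) = h x.
  have [f pf] := lift q (leqnn q) (cdga_comp g e).
  by exists (cdga_comp f e') => x; rewrite /= /gca_comp_fun /= pf /= /gca_comp_fun /= eK.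
elim: i iq h => [|i IHi] iq h.
  have /cdga_inverse[j jK] : bijective (ground_hom (N 0 0)).
    have gI : injective (ground_hom (N 0 0)).
      move=> a b /eqP; rewrite -subr_eq0 -scalerBl scaler_eq0 oner_eq0 orbF subr_eq0.
      exact: eqP.
    have [k kK] := choice N00.
    by exists k => x; [apply: gI |]; exact: esym (kK _).
  exists (cdga_comp (ground_hom P) j) => x; rewrite -[in RHS](jK x) /= /gca_comp_fun /=.
  by rewrite /ground_map !linearZ /= !rmorph1.
apply: (lift_limit (lim i iq)) => [|k f pf].
  exact: IHi (ltnW iq) (cdga_comp h (iota i 0)).
have [iotaE _] := lim i iq.
apply: (lift_hirsch (g := cdga_comp h (iota i k.+1)) iq (hirsch i k iq)) => x.
by rewrite pf /= /gca_comp_fun /= iotaE.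
Qed.
End Lifting.

(** The morphism f need not satisfy phi \o f = g on cochains: it is obtained by a strict
    lift to the path fibration of phi. *)
Lemma q_minimal_lift (K : numFieldType) (q : nat) (M B C : cdga K)
    (phi : cdga_hom B C) (g : cdga_hom M C) :
  q_minimal q M -> q_equivalence q phi -> q_equivalence q g ->
  exists f : cdga_hom M B, q_equivalence q f.
Proof.
move=> Mmin phi_qe g_qe.
have end_qe := fib_end_q_equivalence phi_qe.
have [f fE] := lift_minimal (fib_end_surj phi) end_qe g Mmin.
exists (cdga_comp (fib_base phi) f).
apply: q_equivalence_comp (fib_base_q_equivalence phi q).
exact: q_equivalence_cancel fE end_qe g_qe.
Qed.

Lemma q_minimal_zigzag (K : numFieldType) (q : nat) (M A B : cdga K) (g : cdga_hom M B) :
  q_minimal q M -> q_equivalence q g -> q_type_eq q A B ->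
  exists f : cdga_hom M A, q_equivalence q f.
Proof.
move=> Mmin + AB.
elim: AB g => [|B' B'' phi _ IH phi_qe|B' B'' phi _ IH phi_qe] g g_qe.
- by exists g.
- have [f f_qe] := q_minimal_lift Mmin phi_qe g_qe.
  exact: IH f f_qe.
exact: IH (cdga_comp phi g) (q_equivalence_comp g_qe phi_qe).
Qed.

(** * Finiteness of the cohomology *)

Section Finiteness.
Variables (K : numFieldType) (q : nat) (M A : cdga K) (g : cdga_hom M A).
Hypothesis A_fin : q_finite q A.

Lemma degree_span i : (i <= q)%N ->
  exists e : seq A, forall x, x \in homog A i -> in_span e x.
Proof.
move=> /(A_fin.2 i)/span_finite_dim[e eE]; exists (map val e) => x hx.
have [c /(congr1 val) xE] := eE (exist (fun x => x \in homog A i) x hx).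
exists c; rewrite size_map -[x]/(val (exist (fun x => x \in homog A i) x hx)) xE raddf_sum.
by apply: eq_bigr => j _; rewrite (nth_map 0) //= ltn_ord.
Qed.

Lemma in_span_mul (e1 e2 : seq A) x y : in_span e1 x -> in_span e2 y ->
  in_span [seq a * b | a <- e1, b <- e2] (x * y).
Proof.
move=> [c ->] [d ->]; rewrite mulr_suml; apply: in_span_sum => i.
rewrite mulr_sumr; apply: in_span_sum => j.
rewrite -scalerAl -scalerAr; do 2!apply: in_spanZ.
by apply: mem_in_span; apply: allpairs_f; apply: mem_nth.
Qed.

(** The elements x of M whose component of degree q+1 is mapped into the span D of the
    products of elements of A of degrees 1, .., q form a graded subalgebra: in a product
    x * y the components x_i * y_j with 1 <= i, j <= q are mapped into D by definition,
    and in the remaining ones a factor of degree 0 is mapped to a scalar, as A is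
    connected. This subalgebra contains the generators of M, which have degree at most
    q. *)
Lemma top_degree_span : q_minimal q M ->
  exists e : seq A, forall x, x \in homog M q.+1 -> in_span e (g x).
Proof.
move=> [[V [v M_free]] _].
have [e eE] : exists e : nat -> seq A, forall i, (i <= q)%N ->
    forall x, x \in homog A i -> in_span (e i) x.
  suff /choice[e eE] : forall i, exists e : seq A,
      (i <= q)%N -> forall x, x \in homog A i -> in_span e x by exists e.
  move=> i; have [/degree_span[e eE]|iq] := leqP i q; first by exists e.
  by exists [::].
pose D := flatten [seq [seq a * b | a <- e i, b <- e (q.+1 - i)%N] | i <- iota 0 q.+1].
have DP i x y : (0 < i <= q)%N -> x \in homog A i -> y \in homog A (q.+1 - i) ->
    in_span D (x * y).
  move=> /andP[i0 iq] hx hy.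
  have sub (s t : seq A) : {subset s <= t} -> forall z, in_span s z -> in_span t z.
    move=> st z [c ->]; apply: in_span_sum => j; apply: in_spanZ; apply: mem_in_span.
    by apply: st; exact: mem_nth.
  apply: (sub [seq a * b | a <- e i, b <- e (q.+1 - i)%N]).
    move=> z zi; apply/flattenP; exists [seq a * b | a <- e i, b <- e (q.+1 - i)%N] => //.
    by apply/mapP; exists i => //; rewrite mem_iota ltnS.
  apply: in_span_mul; first exact: eE hx.
  by apply: eE hy; rewrite leq_subLR addnC -addn1 leq_add2l.
pose hc := hcomp (gca_grading M).
pose S : {pred M} := [pred x | `[< in_span D (g (hc q.+1 x)) >]].
have A0 (a x : A) : a \in homog A 0 -> in_span D x -> in_span D (a * x).
  by move=> /A_fin.1[c ->] Dx; rewrite mulr_algl; exact: in_spanZ.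
have A0r (a x : A) : a \in homog A 0 -> in_span D x -> in_span D (x * a).
  by move=> /A_fin.1[c ->] Dx; rewrite mulr_algr; exact: in_spanZ.
have Salg : subalg_closed S.
  split=> [|a x y /asboolP Dx /asboolP Dy|x y /asboolP Dx /asboolP Dy]; apply/asboolP.
  - by rewrite /hc (hcomp_homog _ (gca_one M)) raddf0; exact: in_span0.
  - by rewrite !linearP; exact: in_spanP.
  have [[N xN] [N' yN]] := (hcomp_sum (gca_grading M) x, hcomp_sum (gca_grading M) y).
  rewrite {1}xN {1}yN mulr_suml !raddf_sum; apply: in_span_sum => i.
  rewrite mulr_sumr !raddf_sum; apply: in_span_sum => j.
  have hx n : g (hc n x) \in homog A n by apply: gca_fun_homog; exact: homog_hcomp.
  have hy n : g (hc n y) \in homog A n by apply: gca_fun_homog; exact: homog_hcomp.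
  rewrite /= /hc (hcomp_homog _ (gca_mul (homog_hcomp _ i x) (homog_hcomp _ j y))).
  case: eqP => [ij|_]; last by rewrite raddf0; exact: in_span0.
  rewrite rmorphM -/hc /=.
  have [i0|i0] := posnP i.
    by move: ij; rewrite i0 add0n => <-; apply: A0.
  have [iq|iq] := leqP i q; last first.
    have iE : i = q.+1 :> nat by apply/eqP; rewrite eqn_leq iq ij leq_addr.
    have jE : j = 0 :> nat by apply: (@addnI q.+1); rewrite addn0 [RHS]ij iE.
    by rewrite iE jE; apply: A0r.
  apply: (DP i); rewrite ?i0 //.
  by rewrite ij addKn.
have Shc n x : x \in S -> hcomp (gca_grading M) n x \in S.
  move=> /asboolP Dx; apply/asboolP; rewrite /hc hcompK.
  by case: eqP => [<-//|_]; rewrite raddf0; exact: in_span0.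
exists D => x hx; rewrite -(homogP _ _ _ hx).
apply/asboolP; apply: (free_gca_ind (S := GradedSubalg Salg Shc) M_free) => i w.
apply/asboolP; rewrite /hc (hcomp_homog _ (M_free.1 i w)).
by rewrite eqSS gtn_eqF // raddf0; exact: in_span0.
Qed.

Lemma cohomology_finite n (e : seq A) : coh_inj n g ->
  (forall x, x \in homog M n -> in_span e (g x)) -> finite_dim (cohomology M n).
Proof.
move=> gI ge.
pose F : Zspace M n -> A := fun z => g (val z).
have Fl : linear F by move=> a x y; rewrite /F !linearP.
pose FL := HB.pack_for {linear Zspace M n -> A} F (GRing.isLinear.Build K (Zspace M n) A _ F Fl).
have [//||v vE] := @finite_rank_span _ _ _ FL e (fun=> True).
  by move=> z _; apply: ge; have /cocycleP[] := valP z.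
apply: (@finite_dim_span _ _ [seq cohclass z | z <- v]).
apply: coh_ind => z; have [y yv Fzy] := vE z I.
have -> : cohclass z = cohclass y.
  apply/cohclass_eq; apply: (gI (val (z - y)) (valP (z - y))).
  exists 0; rewrite raddf0; transitivity (FL z - FL y); first exact: (raddfB FL).
  by rewrite Fzy subrr.
have [c ->] := yv; exists c; rewrite size_map.
have -> (F0 : 'I_(size v) -> Zspace M n) :
    cohclass (\sum_i F0 i) = \sum_i cohclass (F0 i).
  apply: (big_morph (@cohclass _ M n) (@cohclassD _ M n)).
  exact: (raddf0 (\pi_(Quotient.quot (coboundary M n)))%qT).
by apply: eq_bigr => k _; rewrite (nth_map 0) // -coh_scaleE.
Qed.
End Finiteness.

Theorem theorem1p2 (R : realType) (q : nat) (X : ptopologicalType)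
    (M : cdga R[i])
    (q_ge1 : (1 <= q)%N)
    (X_path_connected : path_connected R X)
    (X_CW_type : has_CW_type R X)
    (X_q_model : exists A : cdga R[i], q_finite q A /\ is_q_model q X A)
    (M_minimal_model : is_q_minimal_model q M (Omega R R[i] X)) :
  forall i : nat, (i <= q.+1)%N -> finite_dim (cohomology M i).
Proof.
have [A [A_fin A_model]] := X_q_model.
have [Mmin [f f_qe]] := M_minimal_model.
have [g /q_equivalenceP[_ gI]] := q_minimal_zigzag Mmin f_qe A_model.
move=> i iq; suff [e eE] : exists e, forall x, x \in homog M i -> in_span e (g x).
  exact: cohomology_finite (gI i iq) eE.
move: iq; rewrite leq_eqVlt => /orP[/eqP ->|]; first exact: top_degree_span A_fin Mmin.
rewrite ltnS => /(degree_span A_fin)[e eE].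
by exists e => x hx; apply: eE; exact: gca_fun_homog.
Qed.
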